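(* Let $I$ be a countably infinite set and, in the setting described in the context, let $$S(I)=\bigcap_{k\in I}\bigcap_{s=1}^\infty\bigcap_{n=1}^\infty E_{n,k,s}(I),\qquad E_{n,k,s}(I)=\bigcap_{r\in R}\{f\in A(\Omega):\operatorname{Re}(f\circ\phi_r)\restriction_{\mathbb{T}^I}\in D_{n,k,s}(I)\}.$$ Then $S(I)$ is a dense $G_\delta$ subset of $A(\Omega)$.
   Context: For each $i\in I$, $\Omega_i\subset\mathbb{C}$ is a bounded domain whose boundary consists of $k_i$ disjoint Jordan curves; $V_{i,j}$, $j\in\{0,\dots,k_i-1\}$, are the connected components of $\hat{\mathbb{C}}\setminus\overline{\Omega_i}$, $\Omega_{i,j}=\hat{\mathbb{C}}\setminus\overline{V_{i,j}}$, and $\phi_{i,j}:\overline{D}\to\overline{\Omega_{i,j}}$ are fixed Riemann mappings (homeomorphisms of the closed unit disc onto the closure in $\hat{\mathbb{C}}$, conformal from $D$ onto $\Omega_{i,j}$). $\Omega=\prod_{i\in I}\Omega_i$, $\overline{\Omega}=\prod_{i\in I}\overline{\Omega_i}$ with the product topology. $A(\Omega)$ is the space of functions $f:\overline{\Omega}\to\mathbb{C}$ that are continuous on $\overline{\Omega}$ (product topology) and separately holomorphic on $\Omega$ (holomorphic in each variable $z_{i_0}\in\Omega_{i_0}$ when all other coordinates are fixed), with the supremum norm. $R=\prod_{i\in I}\{0,\dots,k_i-1\}$, and for $r=(r_i)\in R$, $\phi_r:\overline{D}^I\to\prod_{i\in I}\overline{\Omega_{i,r_i}}$, $(z_i)\mapsto(\phi_{i,r_i}(z_i))$.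 Functions on $\mathbb{T}^I$ are identified with functions on $\mathbb{R}^I$ that are $2\pi$-periodic in each coordinate via $\theta\mapsto(e^{i\theta_j})_{j\in I}$. For $n,s\in\mathbb{N}$, $k\in I$, $D_{n,k,s}(I)$ is the set of real continuous $u$ on $\mathbb{T}^I$ (product topology) such that for every $\theta\in\mathbb{R}^I$ and every $v\in\mathbb{R}^I$ with $\frac1s\le|v_k|\le s$ and $|v_j|\le s$ for all $j\in I$, there exists $y$ in the segment $\{\theta+tv:-\frac1n<t<\frac1n\}$ with $|u(\theta)-u(y)|>n\|y-\theta\|_\infty$, where $\|x\|_\infty=\sup_{j\in I}|x_j|$. *)

(* Defs.v *)
From Stdlib Require Import Reals ClassicalDescription.
From Coquelicot Require Import Coquelicot.
Open Scope R_scope.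

Definition d_open {X : Type} (d : X -> X -> R) (U : X -> Prop) : Prop :=
  forall x, U x -> exists eps, 0 < eps /\ forall y, d x y < eps -> U y.

Definition d_closure {X : Type} (d : X -> X -> R) (S : X -> Prop) : X -> Prop :=
  fun x => forall eps, 0 < eps -> exists y, S y /\ d x y < eps.

Definition d_connected {X : Type} (d : X -> X -> R) (S : X -> Prop) : Prop :=
  ~ exists U W : X -> Prop, d_open d U /\ d_open d W /\
      (forall x, S x -> U x \/ W x) /\
      (exists x, S x /\ U x) /\ (exists x, S x /\ W x) /\
      (forall x, S x -> U x -> W x -> False).

Definition d_component {X : Type} (d : X -> X -> R) (S P : X -> Prop) : Prop :=
  (exists x, P x) /\ (forall x, P x -> S x) /\ d_connected d P /\
  forall Q : X -> Prop, d_connected d Q -> (forall x, P x -> Q x) ->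
    (forall x, Q x -> S x) -> forall x, Q x -> P x.

Definition cdist (z w : C) : R := Cmod (z - w)%C.

(* Riemann sphere: [None] is the point at infinity *)
Definition Chat := option C.

Definition chord (a b : Chat) : R :=
  match a, b with
  | Some z, Some w => 2 * Cmod (z - w)%C / sqrt ((1 + Cmod z ^ 2) * (1 + Cmod w ^ 2))
  | Some z, None | None, Some z => 2 / sqrt (1 + Cmod z ^ 2)
  | None, None => 0
  end.

(* finite part (only used at points where the value is finite) *)
Definition toC (a : Chat) : C := match a with Some z => z | None => 0%C end.

Definition cexpi (t : R) : C := (cos t, sin t).

Definition holo_at (f : C -> C) (z : C) : Prop :=
  @ex_derive C_AbsRing C_NormedModule f z.

Definition bounded_domain (O : C -> Prop) : Prop :=
  (exists z, O z) /\ d_open cdist O /\ d_connected cdist O /\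
  exists M, forall z, O z -> Cmod z <= M.

Definition jordan_param (g : C -> C) : Prop :=
  (forall z, Cmod z = 1 -> forall eps, 0 < eps -> exists del, 0 < del /\
      forall w, Cmod w = 1 -> cdist z w < del -> cdist (g z) (g w) < eps) /\
  (forall z w, Cmod z = 1 -> Cmod w = 1 -> g z = g w -> z = w).

Definition curve (g : C -> C) : C -> Prop :=
  fun p => exists z, Cmod z = 1 /\ g z = p.

Definition boundary (O : C -> Prop) : C -> Prop :=
  fun p => d_closure cdist O p /\ ~ O p.

Definition boundary_k_jordan (O : C -> Prop) (k : nat) : Prop :=
  exists g : nat -> C -> C,
    (forall j, (j < k)%nat -> jordan_param (g j)) /\
    (forall j j', (j < k)%nat -> (j' < k)%nat -> j <> j' ->
        forall p, curve (g j) p -> curve (g j') p -> False) /\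
    (forall p, boundary O p <-> exists j, (j < k)%nat /\ curve (g j) p).

Definition embed (O : C -> Prop) : Chat -> Prop :=
  fun a => match a with Some z => O z | None => False end.

Definition ext_set (O : C -> Prop) : Chat -> Prop :=
  fun a => ~ d_closure chord (embed O) a.

Definition components_enum (O : C -> Prop) (k : nat) (V : nat -> Chat -> Prop) : Prop :=
  (forall j, (j < k)%nat -> d_component chord (ext_set O) (V j)) /\
  (forall j j', (j < k)%nat -> (j' < k)%nat -> j <> j' -> exists a, V j a /\ ~ V j' a) /\
  (forall P, d_component chord (ext_set O) P ->
     exists j, (j < k)%nat /\ forall a, P a <-> V j a).

Definition Omij (Vj : Chat -> Prop) : Chat -> Prop :=
  fun a => ~ d_closure chord Vj a.

(* holomorphy of a Chat-valued map at z (meromorphic sense: near a pole,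
   1/phi is holomorphic) *)
Definition chat_holo_at (phi : C -> Chat) (z : C) : Prop :=
  match phi z with
  | Some _ => holo_at (fun w => toC (phi w)) z
  | None => holo_at (fun w => match phi w with Some a => (/ a)%C | None => 0%C end) z
  end.

Definition riemann_map (W : Chat -> Prop) (phi : C -> Chat) : Prop :=
  (forall z, Cmod z <= 1 -> d_closure chord W (phi z)) /\
  (forall a, d_closure chord W a -> exists z, Cmod z <= 1 /\ phi z = a) /\
  (forall z w, Cmod z <= 1 -> Cmod w <= 1 -> phi z = phi w -> z = w) /\
  (forall z, Cmod z <= 1 -> forall eps, 0 < eps -> exists del, 0 < del /\
     forall w, Cmod w <= 1 -> cdist z w < del -> chord (phi z) (phi w) < eps) /\
  (forall z, Cmod z <= 1 -> forall eps, 0 < eps -> exists del, 0 < del /\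
     forall w, Cmod w <= 1 -> chord (phi z) (phi w) < del -> cdist z w < eps) /\
  (forall z, Cmod z < 1 -> W (phi z)) /\
  (forall a, W a -> exists z, Cmod z < 1 /\ phi z = a) /\
  (forall z, Cmod z < 1 -> chat_holo_at phi z).

Definition setting {I : Type} (Om : I -> C -> Prop) (k : I -> nat)
  (V : I -> nat -> Chat -> Prop) (phi : I -> nat -> C -> Chat) : Prop :=
  forall i, bounded_domain (Om i) /\ boundary_k_jordan (Om i) (k i) /\
    components_enum (Om i) (k i) (V i) /\
    forall j, (j < k i)%nat -> riemann_map (Omij (V i j)) (phi i j).

Definition upd {I : Type} (x : I -> C) (i0 : I) (w : C) : I -> C :=
  fun j => if excluded_middle_informative (j = i0) then w else x j.

Definition in_Om {I : Type} (Om : I -> C -> Prop) (x : I -> C) : Prop :=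
  forall i, Om i (x i).

(* closure of Omega = product of the closures *)
Definition in_clOm {I : Type} (Om : I -> C -> Prop) (x : I -> C) : Prop :=
  forall i, d_closure cdist (Om i) (x i).

Definition prod_cont_at {I : Type} (P : (I -> C) -> Prop) (f : (I -> C) -> C) (x : I -> C) : Prop :=
  forall eps, 0 < eps -> exists (F : list I) (del : R), 0 < del /\
    forall y, P y -> (forall i, List.In i F -> cdist (y i) (x i) < del) ->
      cdist (f y) (f x) < eps.

Definition inA {I : Type} (Om : I -> C -> Prop) (f : (I -> C) -> C) : Prop :=
  (forall x, in_clOm Om x -> prod_cont_at (in_clOm Om) f x) /\
  (forall x, in_Om Om x -> forall i0, holo_at (fun w => f (upd x i0 w)) (x i0)).

(* sup-norm ball: sup_{closure Omega} |f - g| < eps *)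
Definition supball {I : Type} (Om : I -> C -> Prop) (f g : (I -> C) -> C) (eps : R) : Prop :=
  exists del, del < eps /\ forall x, in_clOm Om x -> Cmod (f x - g x)%C <= del.

Definition openA {I : Type} (Om : I -> C -> Prop) (U : ((I -> C) -> C) -> Prop) : Prop :=
  forall f, inA Om f -> U f -> exists eps, 0 < eps /\
    forall g, inA Om g -> supball Om f g eps -> U g.

Definition GdeltaA {I : Type} (Om : I -> C -> Prop) (S : ((I -> C) -> C) -> Prop) : Prop :=
  exists U : nat -> ((I -> C) -> C) -> Prop,
    (forall m, openA Om (U m)) /\
    forall f, S f <-> (inA Om f /\ forall m, U m f).

Definition denseA {I : Type} (Om : I -> C -> Prop) (S : ((I -> C) -> C) -> Prop) : Prop :=
  (forall f, S f -> inA Om f) /\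
  forall f, inA Om f -> forall eps, 0 < eps -> exists g, S g /\ supball Om f g eps.

Definition in_torus {I : Type} (z : I -> C) : Prop := forall j, Cmod (z j) = 1.

Definition expI {I : Type} (th : I -> R) : I -> C := fun j => cexpi (th j).

Definition is_supnorm {I : Type} (x : I -> R) (M : R) : Prop :=
  is_lub (fun r => exists j, r = Rabs (x j)) M.

Definition D_nks {I : Type} (n : nat) (k : I) (s : nat) (u : (I -> C) -> R) : Prop :=
  (forall z, in_torus z -> forall eps, 0 < eps -> exists (F : list I) (del : R), 0 < del /\
     forall y, in_torus y -> (forall i, List.In i F -> cdist (y i) (z i) < del) ->
       Rabs (u y - u z) < eps) /\
  forall th v : I -> R,
    / INR s <= Rabs (v k) <= INR s ->
    (forall j, Rabs (v j) <= INR s) ->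
    exists t, - / INR n < t < / INR n /\
      let y := fun j => th j + t * v j in
      exists M, is_supnorm (fun j => y j - th j) M /\
        Rabs (u (expI th) - u (expI y)) > INR n * M.

Definition phi_r {I : Type} (phi : I -> nat -> C -> Chat) (r : I -> nat) (z : I -> C) : I -> C :=
  fun i => toC (phi i (r i) (z i)).

Definition E_nks {I : Type} (Om : I -> C -> Prop) (k : I -> nat)
  (phi : I -> nat -> C -> Chat) (n : nat) (kk : I) (s : nat) (f : (I -> C) -> C) : Prop :=
  inA Om f /\
  forall r : I -> nat, (forall i, (r i < k i)%nat) ->
    D_nks n kk s (fun z => Re (f (phi_r phi r z))).

Definition S_I {I : Type} (Om : I -> C -> Prop) (k : I -> nat)
  (phi : I -> nat -> C -> Chat) (f : (I -> C) -> C) : Prop :=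
  inA Om f /\
  forall (kk : I) (s n : nat), (1 <= s)%nat -> (1 <= n)%nat -> E_nks Om k phi n kk s f.

(* Main.v *)
Require Import Defs.
From Stdlib Require Import Reals Lra Lia Classical ClassicalEpsilon FunctionalExtensionality Cantor.
From Coquelicot Require Import Coquelicot.
Open Scope R_scope.

(** In the definition of [S_I] the sup norm of [t v] may be replaced by [|t|], since all slopes are
    allowed; the resulting conditions are open in [A(Omega)] because the parameters [(r, theta, v)]
    range over a compact product, and this gives the G-delta property.

    For density, [f] is perturbed by a series of functions [a_m H_m(z_i)] of one variable. Each [H_m]
    is a finite sum of bumps [(b - p) / (z - p)], where [p] lies in a complementary component of
    [Omega_i] close to its boundary and [b] is the point of the closure of [Omega_i] nearest to [p].
    Such a bump has modulus at most [1], takes the value [1] at the boundary point [b] and is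
    negligible away from it, so [H_m] is bounded by [2] and oscillates by a fixed amount on every
    short boundary arc, while the previous partial sum, being uniformly continuous, is almost
    constant there. With [a_m] decreasing geometrically the later terms do not spoil this. Simple
    poles outside [Omega_i] satisfy a quadratic differentiability estimate that passes to pointwise
    limits, so the sum is holomorphic in each variable. *)

(** The set [R] of choices [r] may be uncountable, but a perturbation in the variable [i0] alone
    sees [r] only through [r i0]. The conditions therefore split into countably many, indexed by a
    slope [q], a coordinate [i0] and a component [j < k i0], and one term of the series settles one
    of them for all [r] with [r i0 = j] at once. A prescribed boundary point need not be nearest to
    any point of the complement (a reentrant corner of the domain, for instance), and a bump peaking
    exactly there need not be bounded by 1. So the peak is placed at a nearby boundary point, known
    only up to a small error; this suffices for oscillation on short arcs. The ratio [/ 100] of the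
    amplitudes is a matter of balance: step [m] gains a margin [a m / 8], while all later terms
    together move the sum by at most [4/99 * a m] at each of the two points compared. *)

(** * Cluster points in countable products *)

Definition frequently_near (X : nat -> nat -> R) (x : nat -> R) (n : nat) : Prop :=
  forall del M, 0 < del -> exists m, (M <= m)%nat /\
    forall i, (i < n)%nat -> Rabs (X m i - x i) < del.

(* The new coordinate is the upper limit of [X m n] along the indices where
   the first [n] coordinates are close to [x]. *)
Lemma frequently_near_extend X B n x :
  (forall m, Rabs (X m n) <= B) -> frequently_near X x n ->
  exists c, frequently_near X (fun i => if Nat.eqb i n then c else x i) (S n).
Proof.
  intros HB Hx.
  set (E := fun c => forall del M, 0 < del -> exists m, (M <= m)%nat /\
    (forall i, (i < n)%nat -> Rabs (X m i - x i) < del) /\ c <= X m n).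
  destruct (completeness E) as [c [Hub Hlub]].
  - exists B. intros c Hc. destruct (Hc 1 0%nat Rlt_0_1) as [m [_ [_ Hm]]].
    generalize (Rle_abs (X m n)) (HB m). lra.
  - exists (- B). intros del M Hdel. destruct (Hx del M Hdel) as [m [H1 H2]].
    exists m. split; [exact H1 | split; [exact H2|]].
    generalize (HB m). unfold Rabs; destruct (Rcase_abs (X m n)); lra.
  - exists c. intros del M Hdel.
    assert (H1 : exists c', E c' /\ c - del < c').
    { apply NNPP. intros H. assert (c <= c - del); [|lra].
      apply Hlub. intros y Hy. apply Rnot_lt_le. intros Hlt. apply H. exists y. tauto. }
    assert (H2 : ~ E (c + del / 2)).
    { intros H. generalize (Hub _ H). lra. }
    destruct H1 as [c' [Hc' Hcc]].
    assert (H3 : exists d0 M0, 0 < d0 /\ forall m, (M0 <= m)%nat ->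
      (forall i, (i < n)%nat -> Rabs (X m i - x i) < d0) -> X m n < c + del / 2).
    { apply NNPP. intros H. apply H2. intros d0 M0 Hd0. apply NNPP. intros H'.
      apply H. exists d0, M0. split; [exact Hd0|]. intros m Hm Hi.
      apply Rnot_le_lt. intros Hle. apply H'. exists m. tauto. }
    destruct H3 as [d0 [M0 [Hd0 H3]]].
    destruct (Hc' (Rmin del d0) (Nat.max M M0)) as [m [Hm [Hi Hcm]]].
    { apply Rmin_glb_lt; assumption. }
    exists m. split; [lia|]. intros i Hin.
    destruct (Nat.eqb_spec i n) as [->|Hne].
    + assert (X m n < c + del / 2).
      { apply H3; [lia|]. intros i Hi'. apply Rlt_le_trans with (1 := Hi i Hi'). apply Rmin_r. }
      apply Rabs_def1; lra.
    + apply Rlt_le_trans with (Rmin del d0); [apply Hi; lia | apply Rmin_l].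
Qed.

(** Sequential Tychonoff theorem for a countable product of intervals. Coordinates are chosen
    recursively by [frequently_near_extend]; since only clustering is recorded and no subsequence is
    extracted, no diagonal sequence is needed. *)
Lemma cluster_point (X : nat -> nat -> R) (B : nat -> R) :
  (forall m i, Rabs (X m i) <= B i) -> exists x, forall n, frequently_near X x n.
Proof.
  intros HB.
  set (pick := fun n x => epsilon (inhabits 0)
    (fun c => frequently_near X (fun i => if Nat.eqb i n then c else x i) (S n))).
  set (pre := fix pre n : nat -> R := match n with
    | O => fun _ => 0
    | S n => fun i => if Nat.eqb i n then pick n (pre n) else pre n i end).
  assert (Hpre : forall n, frequently_near X (pre n) n).
  { induction n as [|n IH].
    - intros del M Hdel. exists M. split; [lia|]. intros; lia.
    - apply (epsilon_spec (inhabits 0)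
        (fun c => frequently_near X (fun i => if Nat.eqb i n then c else pre n i) (S n))).
      apply frequently_near_extend with (B n); auto. }
  assert (Heq : forall n i, (i < n)%nat -> pre n i = pre (S i) i).
  { induction n as [|n IH]; intros i Hi; [lia|].
    destruct (Nat.eq_dec i n) as [->|Hne]; [reflexivity|].
    rewrite <- IH by lia. simpl. destruct (Nat.eqb_spec i n); [lia|reflexivity]. }
  exists (fun i => pre (S i) i). intros n del M Hdel.
  destruct (Hpre n del M Hdel) as [m [Hm Hi]]. exists m. split; [exact Hm|].
  intros i Hin. rewrite <- (Heq n i Hin). auto.
Qed.

(** * Quantitative holomorphy *)

Lemma Cmod_minus_sym (a b : C) : Cmod (a - b) = Cmod (b - a).
Proof. rewrite <- Cmod_opp. f_equal. ring. Qed.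

Lemma Cmod_minus_triangle (a b c : C) : Cmod (a - c) <= Cmod (a - b) + Cmod (b - c).
Proof. replace (a - c)%C with ((a - b) + (b - c))%C by ring. apply Cmod_triangle. Qed.

Lemma Cmod_le_minus (a b : C) : Cmod a <= Cmod b + Cmod (a - b).
Proof. replace a with (b + (a - b))%C at 1 by ring. apply Cmod_triangle. Qed.

Lemma Im_le_Cmod (z : C) : Rabs (Im z) <= Cmod z.
Proof. eapply Rle_trans; [apply Rmax_r | apply Rmax_Cmod]. Qed.

Lemma Cmod_le_Re_Im (z : C) : Cmod z <= Rabs (Re z) + Rabs (Im z).
Proof.
  assert (H1 := Rabs_pos (Re z)). assert (H2 := Rabs_pos (Im z)).
  apply Rsqr_incr_0_var; [|lra]. rewrite !Rsqr_pow2, Cmod2_alt.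
  rewrite <- (pow2_abs (Re z)), <- (pow2_abs (Im z)). nra.
Qed.

Lemma C_cluster_point (z : nat -> C) (M : R) : (forall m, Cmod (z m) <= M) ->
  exists c, forall del N, 0 < del -> exists m, (N <= m)%nat /\ Cmod (z m - c) < del.
Proof.
  intros HM.
  destruct (cluster_point (fun m i => match i with O => Re (z m) | _ => Im (z m) end)
    (fun _ => M)) as [x Hx].
  { intros m [|i]; (eapply Rle_trans; [|apply (HM m)]); [apply re_le_Cmod | apply Im_le_Cmod]. }
  exists (x 0%nat, x 1%nat). intros del N Hdel.
  destruct (Hx 2%nat (del / 2) N ltac:(lra)) as [m [Hm Hi]]. exists m. split; [exact Hm|].
  eapply Rle_lt_trans; [apply Cmod_le_Re_Im|].
  assert (H0 := Hi 0%nat ltac:(lia)). assert (H1 := Hi 1%nat ltac:(lia)).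
  unfold Re, Im in *; simpl in *. unfold Rminus in *. lra.
Qed.

(** The intervals with centre [u m] and radius [c * (/100)^m] are nested, [c] being
    [A / (1 - 1/100)]; the limit is the supremum of their left ends. *)
Lemma R_geometric_limit (u : nat -> R) (A : R) :
  (forall m, Rabs (u (S m) - u m) <= A * (/ 100) ^ m) ->
  exists y, forall m, Rabs (u m - y) <= 100 / 99 * A * (/ 100) ^ m.
Proof.
  intros H. set (c := 100 / 99 * A).
  assert (Hs : forall m p, u m - c * (/100)^m <= u (m + p)%nat - c * (/100)^(m + p)
    /\ u (m + p)%nat + c * (/100)^(m + p) <= u m + c * (/100)^m).
  { intros m p. induction p as [|p IH].
    - rewrite Nat.add_0_r. lra.
    - rewrite Nat.add_succ_r. assert (Hp := H (m + p)%nat). revert Hp IH.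
      simpl pow. set (P := (/100)^(m + p)). intros Hp IH.
      apply Rabs_le_between in Hp. unfold c in *. lra. }
  assert (HA : 0 <= A).
  { assert (Hp := H 0%nat). simpl in Hp. generalize (Rabs_pos (u 1%nat - u 0%nat)). lra. }
  assert (Hpos : forall m, 0 <= c * (/100)^m).
  { intros m. apply Rmult_le_pos; [unfold c; lra|]. apply pow_le. lra. }
  assert (Hc : forall m p, u m - c * (/100)^m <= u p + c * (/100)^p).
  { intros m p. destruct (Hs m p) as [H1 _]. destruct (Hs p m) as [_ H2].
    rewrite Nat.add_comm in H2. generalize (Hpos (m + p)%nat). lra. }
  destruct (completeness (fun r => exists m, r = u m - c * (/100)^m)) as [y [Hy1 Hy2]].
  - exists (u 0%nat + c * (/100)^0). intros r [m ->]. apply Hc.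
  - exists (u 0%nat - c * (/100)^0), 0%nat. reflexivity.
  - exists y. intros m. apply Rabs_le_between. split.
    + assert (y <= u m + c * (/100)^m); [|lra]. apply Hy2. intros r [p ->]. apply Hc.
    + assert (u m - c * (/100)^m <= y); [|lra]. apply Hy1. exists m. reflexivity.
Qed.

(** The constant doubles because real and imaginary parts are estimated separately. *)
Lemma C_geometric_limit (u : nat -> C) (A : R) :
  (forall m, Cmod (u (S m) - u m) <= A * (/ 100) ^ m) ->
  exists y : C, forall m, Cmod (u m - y) <= 200 / 99 * A * (/ 100) ^ m.
Proof.
  intros H.
  destruct (R_geometric_limit (fun m => Re (u m)) A) as [a Ha].
  { intros m. eapply Rle_trans; [|apply H]. apply (re_le_Cmod (u (S m) - u m)%C). }
  destruct (R_geometric_limit (fun m => Im (u m)) A) as [b Hb].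
  { intros m. eapply Rle_trans; [|apply H]. apply (Im_le_Cmod (u (S m) - u m)%C). }
  exists (a, b). intros m. eapply Rle_trans; [apply Cmod_le_Re_Im|].
  assert (H1 := Ha m). assert (H2 := Hb m).
  unfold Re, Im in *; simpl in *. unfold Rminus in *. lra.
Qed.

Lemma holo_at_of_quadratic_bound (f : C -> C) (x d : C) (K rho : R) : 0 < rho ->
  (forall w, Cmod (w - x) < rho -> Cmod (f w - f x - d * (w - x)) <= K * Cmod (w - x) ^ 2) ->
  holo_at f x.
Proof.
  intros Hrho H. exists d. split; [apply is_linear_scal_l|].
  intros y Hy. apply (@is_filter_lim_locally_unique C_AbsRing (AbsRing_NormedModule C_AbsRing) x y) in Hy. subst y.
  intros eps. assert (HK : 0 < Rabs K + 1) by (generalize (Rabs_pos K); lra).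
  assert (Hdel : 0 < Rmin rho (eps / (Rabs K + 1))).
  { apply Rmin_glb_lt; [exact Hrho|]. apply Rdiv_lt_0_compat; [apply cond_pos|exact HK]. }
  exists (mkposreal _ Hdel). intros w Hw.
  assert (Hw' : Cmod (w - x) < Rmin rho (eps / (Rabs K + 1))) by exact Hw.
  change (Cmod (f w - f x - (w - x) * d) <= eps * Cmod (w - x)).
  rewrite (Cmult_comm (w - x) d).
  eapply Rle_trans.
  { apply H. eapply Rlt_le_trans; [exact Hw'|apply Rmin_l]. }
  assert (H1 : Cmod (w - x) < eps / (Rabs K + 1)).
  { eapply Rlt_le_trans; [exact Hw'|apply Rmin_r]. }
  assert (H0 := Cmod_ge_0 (w - x)).
  assert (H2 : Cmod (w - x) * (Rabs K + 1) < eps).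
  { apply Rmult_lt_reg_r with (/ (Rabs K + 1)); [apply Rinv_0_lt_compat; lra|].
    rewrite Rmult_assoc, Rinv_r by lra. rewrite Rmult_1_r. exact H1. }
  assert (H3 := Rle_abs K). nra.
Qed.

(* A quantitative form of holomorphy on an open set [O]; it passes to pointwise
   limits without Cauchy's integral formula. *)
Definition quad_diff (O : C -> Prop) (kap : R) (H : C -> C) : Prop :=
  forall x rho, 0 < rho -> (forall w, Cmod (w - x) < rho -> O w) ->
    exists d : C, forall w, Cmod (w - x) < rho / 2 ->
      Cmod (H w - H x - d * (w - x)) <= kap * (2 / rho ^ 3) * Cmod (w - x) ^ 2.

Lemma quad_diff_const (O : C -> Prop) (c : C) : quad_diff O 0 (fun _ => c).
Proof.
  intros x rho Hrho HO. exists 0%C. intros w _.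
  cbv beta. replace (c - c - RtoC 0 * (w - x))%C with (RtoC 0) by ring. rewrite Cmod_0. lra.
Qed.

Lemma quad_diff_plus O k1 k2 H1 H2 : quad_diff O k1 H1 -> quad_diff O k2 H2 ->
  quad_diff O (k1 + k2) (fun w => H1 w + H2 w)%C.
Proof.
  intros Q1 Q2 x rho Hrho HO.
  destruct (Q1 x rho Hrho HO) as [d1 D1]. destruct (Q2 x rho Hrho HO) as [d2 D2].
  exists (d1 + d2)%C. intros w Hw.
  replace (H1 w + H2 w - (H1 x + H2 x) - (d1 + d2) * (w - x))%C
    with ((H1 w - H1 x - d1 * (w - x)) + (H2 w - H2 x - d2 * (w - x)))%C by ring.
  eapply Rle_trans; [apply Cmod_triangle|].
  assert (A1 := D1 w Hw). assert (A2 := D2 w Hw). lra.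
Qed.

Lemma quad_diff_scal O k a H : 0 <= a -> quad_diff O k H ->
  quad_diff O (a * k) (fun w => a * H w)%C.
Proof.
  intros Ha Q x rho Hrho HO. destruct (Q x rho Hrho HO) as [d D].
  exists (a * d)%C. intros w Hw.
  replace (a * H w - a * H x - a * d * (w - x))%C
    with (a * (H w - H x - d * (w - x)))%C by ring.
  rewrite Cmod_mult, Cmod_R, Rabs_pos_eq by exact Ha.
  rewrite !Rmult_assoc. apply Rmult_le_compat_l; [exact Ha|].
  rewrite <- Rmult_assoc. apply D. exact Hw.
Qed.

Lemma quad_diff_weaken O k k' H : k <= k' -> quad_diff O k H -> quad_diff O k' H.
Proof.
  intros Hk Q x rho Hrho HO. destruct (Q x rho Hrho HO) as [d D].
  exists d. intros w Hw. eapply Rle_trans; [apply D; exact Hw|].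
  assert (0 < 2 / rho ^ 3) by (apply Rdiv_lt_0_compat; [lra|apply pow_lt; lra]).
  assert (0 <= Cmod (w - x) ^ 2) by (apply pow_le, Cmod_ge_0).
  apply Rmult_le_compat_r; [assumption|]. apply Rmult_le_compat_r; lra.
Qed.

(** The remainder is exactly [c * (w - x)^2 / ((w - p) * (x - p)^2)]. The disc of radius [rho]
    misses [p], so the factors at [x] are at least [rho] and the one at [w] is at least [rho / 2]:
    this is the origin of [2 / rho ^ 3] in [quad_diff]. *)
Lemma quad_diff_simple_pole O (c p : C) : ~ O p ->
  quad_diff O (Cmod c) (fun w => c / (w - p))%C.
Proof.
  intros Hp x rho Hrho HO.
  assert (Hx : rho <= Cmod (x - p)).
  { apply Rnot_lt_le. intros Hlt. apply Hp, HO. rewrite Cmod_minus_sym. exact Hlt. }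
  assert (Hx0 : (x - p)%C <> 0) by (apply Cmod_gt_0; lra).
  exists (- (c / ((x - p) * (x - p))))%C. intros w Hw.
  assert (Hwp : rho / 2 <= Cmod (w - p)).
  { generalize (Cmod_minus_triangle x w p). rewrite (Cmod_minus_sym x w). lra. }
  assert (Hw0 : (w - p)%C <> 0) by (apply Cmod_gt_0; lra).
  replace (c / (w - p) - c / (x - p) - - (c / ((x - p) * (x - p))) * (w - x))%C
    with (c * / (w - p) * / (x - p) * / (x - p) * (w - x) * (w - x))%C
    by (field; split; assumption).
  rewrite !Cmod_mult, !Cmod_inv by assumption.
  replace (Cmod c * (2 / rho ^ 3) * Cmod (w - x) ^ 2)
    with (Cmod c * / (rho / 2) * / rho * / rho * Cmod (w - x) * Cmod (w - x)) by (field; lra).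
  assert (0 <= / Cmod (x - p)) by (left; apply Rinv_0_lt_compat; lra).
  assert (0 <= / Cmod (w - p)) by (left; apply Rinv_0_lt_compat; lra).
  assert (/ Cmod (x - p) <= / rho) by (apply Rinv_le_contravar; lra).
  assert (/ Cmod (w - p) <= / (rho / 2)) by (apply Rinv_le_contravar; lra).
  assert (0 <= Cmod c) by apply Cmod_ge_0. assert (0 <= Cmod (w - x)) by apply Cmod_ge_0.
  repeat (apply Rmult_le_compat; [repeat apply Rmult_le_pos; assumption | assumption | |]);
    try assumption; try apply Rle_refl.
Qed.

Lemma le_of_le_plus_eps_mult (a b K : R) :
  (forall eps, 0 < eps -> a <= b + K * eps) -> a <= b.
Proof.
  intros H. apply Rnot_lt_le. intros Hlt.
  assert (HK : 0 < Rabs K + 1) by (generalize (Rabs_pos K); lra).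
  assert (H1 := H ((a - b) / (2 * (Rabs K + 1))) ltac:(apply Rdiv_lt_0_compat; lra)).
  assert (H2 : K * ((a - b) / (2 * (Rabs K + 1))) <= (a - b) / 2).
  { replace ((a - b) / 2) with ((Rabs K + 1) * ((a - b) / (2 * (Rabs K + 1)))) by (field; lra).
    apply Rmult_le_compat_r; [left; apply Rdiv_lt_0_compat; lra|].
    generalize (Rle_abs K). lra. }
  lra.
Qed.

(* The derivatives at [x] are bounded, since they are controlled by difference
   quotients; any cluster point of them works for the limit. *)
Lemma quad_diff_limit O k (u : nat -> C -> C) (g : C -> C) :
  (forall m, quad_diff O k (u m)) ->
  (forall w, O w -> forall eps, 0 < eps -> exists N, forall m, (N <= m)%nat ->
    Cmod (u m w - g w) < eps) ->
  quad_diff O k g.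
Proof.
  intros Q L x rho Hrho HO.
  set (K := k * (2 / rho ^ 3)).
  assert (Hd : forall m, exists d : C, forall w, Cmod (w - x) < rho / 2 ->
      Cmod (u m w - u m x - d * (w - x)) <= K * Cmod (w - x) ^ 2).
  { intros m. apply (Q m x rho Hrho HO). }
  set (d := fun m => proj1_sig (constructive_indefinite_description _ (Hd m))).
  assert (D : forall m w, Cmod (w - x) < rho / 2 ->
      Cmod (u m w - u m x - d m * (w - x)) <= K * Cmod (w - x) ^ 2).
  { intros m. apply (proj2_sig (constructive_indefinite_description _ (Hd m))). }
  clearbody d. clear Hd.
  assert (Ox : O x).
  { apply HO. replace (x - x)%C with (RtoC 0) by ring. rewrite Cmod_0. exact Hrho. }
  (* A fixed point of the half disc; the difference quotients at [y] bound the derivatives uniformly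
     in [m]. *)
  set (y := (x + RtoC (rho / 4))%C).
  assert (Hyx : (y - x)%C = RtoC (rho / 4)) by (unfold y; ring).
  assert (Hy : Cmod (y - x) = rho / 4).
  { rewrite Hyx, Cmod_R. apply Rabs_pos_eq. lra. }
  assert (Oy : O y) by (apply HO; lra).
  destruct (L x Ox 1 Rlt_0_1) as [N1 L1]. destruct (L y Oy 1 Rlt_0_1) as [N2 L2].
  set (N := Nat.max N1 N2).
  set (M := (K * (rho / 4) ^ 2 + 2 + Cmod (g y - g x)) / (rho / 4)).
  assert (Hb : forall m, Cmod (d (N + m)%nat) <= M).
  { intros m. apply Rmult_le_reg_r with (rho / 4); [lra|].
    unfold M. replace ((K * (rho / 4) ^ 2 + 2 + Cmod (g y - g x)) / (rho / 4) * (rho / 4))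
      with (K * (rho / 4) ^ 2 + 2 + Cmod (g y - g x)) by (field; lra).
    rewrite <- Hy at 1. rewrite <- Cmod_mult.
    assert (D1 := D (N + m)%nat y ltac:(lra)). rewrite Hy in D1.
    assert (A1 := L1 (N + m)%nat ltac:(lia)). assert (A2 := L2 (N + m)%nat ltac:(lia)).
    set (z := (d (N + m)%nat * (y - x))%C) in *.
    assert (B := Cmod_minus_triangle (u (N+m)%nat y - u (N+m)%nat x) (g y - g x) 0).
    assert (B2 := Cmod_triangle (u (N+m)%nat y - g y) (g x - u (N+m)%nat x)).
    rewrite (Cmod_minus_sym (g x)) in B2.
    replace (u (N + m)%nat y - g y + (g x - u (N + m)%nat x))%C
      with (u (N + m)%nat y - u (N + m)%nat x - (g y - g x))%C in B2 by ring.
    replace (u (N + m)%nat y - u (N + m)%nat x - 0)%C with (u (N + m)%nat y - u (N + m)%nat x)%C in B by ring.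
    replace (g y - g x - 0)%C with (g y - g x)%C in B by ring.
    assert (B3 := Cmod_le_minus z (u (N + m)%nat y - u (N + m)%nat x)).
    rewrite (Cmod_minus_sym z) in B3. lra. }
  destruct (C_cluster_point (fun m => d (N + m)%nat) M Hb) as [c Hc].
  exists c. intros w Hw. fold K.
  (* The errors are [eps] for the value at [x], [eps] for the value at [w], and [eps * Cmod (w - x)]
     for the derivative. *)
  apply (le_of_le_plus_eps_mult _ _ (2 + Cmod (w - x))). intros eps Heps.
  assert (Ow : O w) by (apply HO; lra).
  destruct (L x Ox eps Heps) as [M1 K1]. destruct (L w Ow eps Heps) as [M2 K2].
  destruct (Hc eps (Nat.max M1 M2) Heps) as [m [Hm Hcm]].
  set (p := (N + m)%nat) in *.
  assert (E1 := K1 p ltac:(unfold p; lia)). assert (E2 := K2 p ltac:(unfold p; lia)).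
  assert (E3 := D p w Hw).
  replace (g w - g x - c * (w - x))%C with
    ((u p w - u p x - d p * (w - x)) + ((g w - u p w) + ((u p x - g x) + (d p - c) * (w - x))))%C by ring.
  eapply Rle_trans; [apply Cmod_triangle|].
  assert (T1 := Cmod_triangle (g w - u p w) ((u p x - g x) + (d p - c) * (w - x))).
  assert (T2 := Cmod_triangle (u p x - g x) ((d p - c) * (w - x))).
  rewrite Cmod_mult in T2. rewrite (Cmod_minus_sym (g w)) in T1.
  assert (T3 : Cmod (d p - c) * Cmod (w - x) <= eps * Cmod (w - x)).
  { apply Rmult_le_compat_r; [apply Cmod_ge_0 | lra]. }
  lra.
Qed.

Lemma quad_diff_holo_at O k H x : d_open cdist O -> quad_diff O k H -> O x -> holo_at H x.
Proof.
  intros HO Q Hx. destruct (HO x Hx) as [rho [Hrho Hr]].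
  destruct (Q x rho Hrho) as [d D].
  { intros w Hw. apply Hr. unfold cdist. rewrite Cmod_minus_sym. exact Hw. }
  apply (holo_at_of_quadratic_bound H x d (k * (2 / rho ^ 3)) (rho / 2)); [lra|exact D].
Qed.

(** * Complementary components in the Riemann sphere *)

Lemma sqrt_1_sqr_bounds (x : R) : 0 <= x -> 1 <= sqrt (1 + x ^ 2) <= 1 + x /\ x <= sqrt (1 + x ^ 2).
Proof.
  intros Hx. repeat split.
  - rewrite <- sqrt_1 at 1. apply sqrt_le_1_alt. nra.
  - rewrite <- (sqrt_pow2 (1 + x)) by lra. apply sqrt_le_1_alt. nra.
  - rewrite <- (sqrt_pow2 x) at 1 by lra. apply sqrt_le_1_alt. nra.
Qed.

Lemma chord_Some (a b : C) : chord (Some a) (Some b) =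
  2 * Cmod (a - b) / (sqrt (1 + Cmod a ^ 2) * sqrt (1 + Cmod b ^ 2)).
Proof. unfold chord. rewrite sqrt_mult_alt by nra. reflexivity. Qed.

Lemma chord_le_Cmod (a b : C) : chord (Some a) (Some b) <= 2 * Cmod (a - b).
Proof.
  rewrite chord_Some.
  destruct (sqrt_1_sqr_bounds (Cmod a) (Cmod_ge_0 a)) as [[Ha _] _].
  destruct (sqrt_1_sqr_bounds (Cmod b) (Cmod_ge_0 b)) as [[Hb _] _].
  set (s := sqrt (1 + Cmod a ^ 2)) in *. set (t := sqrt (1 + Cmod b ^ 2)) in *.
  assert (H := Cmod_ge_0 (a - b)). assert (Hst : 1 <= s * t) by nra.
  apply Rle_div_l; [lra|]. nra.
Qed.

Lemma Cmod_le_chord (M : R) (a b : C) : Cmod a <= M -> Cmod b <= M ->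
  Cmod (a - b) <= (1 + M) ^ 2 * chord (Some a) (Some b).
Proof.
  intros HaM HbM. rewrite chord_Some.
  destruct (sqrt_1_sqr_bounds (Cmod a) (Cmod_ge_0 a)) as [[Ha Ha'] _].
  destruct (sqrt_1_sqr_bounds (Cmod b) (Cmod_ge_0 b)) as [[Hb Hb'] _].
  set (s := sqrt (1 + Cmod a ^ 2)) in *. set (t := sqrt (1 + Cmod b ^ 2)) in *.
  assert (H := Cmod_ge_0 (a - b)).
  assert (Hst : s * t <= (1 + M) ^ 2) by nra.
  apply Rmult_le_reg_r with (s * t); [nra|].
  replace ((1 + M) ^ 2 * (2 * Cmod (a - b) / (s * t)) * (s * t))
    with ((1 + M) ^ 2 * (2 * Cmod (a - b))) by (field; split; lra).
  nra.
Qed.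

Lemma chord_near_finite (p : C) (del : R) : 0 < del -> exists eps, 0 < eps /\
  forall y, chord (Some p) y < eps -> exists q, y = Some q /\ Cmod (p - q) < del.
Proof.
  intros Hdel. assert (HP := Cmod_ge_0 p). set (P := Cmod p) in *.
  destruct (sqrt_1_sqr_bounds P HP) as [[Hp Hp'] _].
  (* A finite point at distance [d] has chordal distance at least [2 * d / ((1 + P) * (1 + P + d))],
     which increases with [d]; its limit [2 / (1 + P)] bounds the distance to infinity from
     below. *)
  exists (2 * del / ((1 + P) * (1 + P + del))). split.
  { apply Rdiv_lt_0_compat; nra. }
  intros [q|].
  - rewrite chord_Some. fold P. intros Hlt. exists q. split; [reflexivity|].
    destruct (sqrt_1_sqr_bounds (Cmod q) (Cmod_ge_0 q)) as [[Hq Hq'] _].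
    apply Rnot_le_lt. intros Hge.
    assert (Hqd : Cmod q <= P + Cmod (p - q)).
    { rewrite Cmod_minus_sym. apply Cmod_le_minus. }
    set (s := sqrt (1 + P ^ 2)) in *. set (t := sqrt (1 + Cmod q ^ 2)) in *.
    set (d := Cmod (p - q)) in *.
    apply (Rlt_not_le _ _ Hlt).
    apply Rle_trans with (2 * d / ((1 + P) * (1 + P + d))).
    + apply Rmult_le_reg_r with ((1 + P) * (1 + P + d) * (1 + P + del)).
      { apply Rmult_lt_0_compat; [nra|lra]. }
      replace (2 * del / ((1 + P) * (1 + P + del)) * ((1 + P) * (1 + P + d) * (1 + P + del)))
        with (2 * del * (1 + P + d)) by (field; lra).
      replace (2 * d / ((1 + P) * (1 + P + d)) * ((1 + P) * (1 + P + d) * (1 + P + del)))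
        with (2 * d * (1 + P + del)) by (field; lra).
      nra.
    + apply Rmult_le_compat_l; [lra|]. apply Rinv_le_contravar; [nra|].
      apply Rmult_le_compat; lra.
  - unfold chord. fold P. intros Hlt. exfalso. apply (Rlt_not_le _ _ Hlt).
    apply Rle_trans with (2 / (1 + P)).
    + apply Rle_div_l; [nra|]. replace (2 / (1 + P) * ((1 + P) * (1 + P + del)))
        with (2 * (1 + P + del)) by (field; lra). lra.
    + apply Rmult_le_compat_l; [lra|]. apply Rinv_le_contravar; lra.
Qed.

Lemma chord_near_infinity (M : R) : 0 <= M -> exists eps, 0 < eps /\
  forall y, chord None y < eps -> y = None \/ exists q, y = Some q /\ M < Cmod q.
Proof.
  intros HM. exists (2 / (1 + M)). split; [apply Rdiv_lt_0_compat; lra|].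
  intros [q|]; [|left; reflexivity]. unfold chord. intros Hlt. right.
  exists q. split; [reflexivity|]. apply Rnot_le_lt. intros Hle.
  destruct (sqrt_1_sqr_bounds (Cmod q) (Cmod_ge_0 q)) as [[Hq Hq'] _].
  apply (Rlt_not_le _ _ Hlt). apply Rmult_le_compat_l; [lra|]. apply Rinv_le_contravar; lra.
Qed.

Lemma chord_refl (a : Chat) : chord a a = 0.
Proof.
  destruct a as [z|]; [|reflexivity]. rewrite chord_Some.
  replace (z - z)%C with (RtoC 0) by ring. rewrite Cmod_0. unfold Rdiv. ring.
Qed.

Lemma closure_embed_Some (O : C -> Prop) (p : C) :
  d_closure chord (embed O) (Some p) <-> d_closure cdist O p.
Proof.
  split; intros H eps Heps.
  - destruct (chord_near_finite p eps Heps) as [e' [He' Hn]].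
    destruct (H e' He') as [y [Hy Hd]]. destruct (Hn y Hd) as [q [-> Hq]].
    exists q. split; [exact Hy|exact Hq].
  - destruct (H (eps / 2) ltac:(lra)) as [q [Hq Hd]]. unfold cdist in Hd.
    exists (Some q). split; [exact Hq|]. eapply Rle_lt_trans; [apply chord_le_Cmod|]. lra.
Qed.

Lemma closure_Cmod_le (O : C -> Prop) (M : R) (p : C) :
  (forall z, O z -> Cmod z <= M) -> d_closure cdist O p -> Cmod p <= M.
Proof.
  intros HM H. apply Rnot_lt_le. intros Hlt.
  destruct (H (Cmod p - M) ltac:(lra)) as [y [Hy Hd]]. unfold cdist in Hd.
  generalize (HM y Hy) (Cmod_le_minus p y). lra.
Qed.

Lemma ext_set_Some (O : C -> Prop) (p : C) : ext_set O (Some p) <-> ~ d_closure cdist O p.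
Proof. unfold ext_set. rewrite closure_embed_Some. reflexivity. Qed.

Lemma ext_set_None (O : C -> Prop) (M : R) : (forall z, O z -> Cmod z <= M) -> ext_set O None.
Proof.
  intros HM H. destruct (chord_near_infinity (Rmax M 0) (Rmax_r _ _)) as [eps [Heps Hn]].
  destruct (H eps Heps) as [y [Hy Hd]]. destruct (Hn y Hd) as [->|[q [-> Hq]]]; [exact Hy|].
  generalize (HM q Hy) (Rmax_l M 0). lra.
Qed.

Definition path_cont (g : R -> Chat) : Prop :=
  forall t, 0 <= t <= 1 -> forall eps, 0 < eps -> exists del, 0 < del /\
    forall t', 0 <= t' <= 1 -> Rabs (t' - t) < del -> chord (g t) (g t') < eps.

(** Let [c] be the supremum of the parameters in [[s, t]] sent into [U]. If [g c] is in [U],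
    openness pushes past [c]; if it is in [W], openness excludes [U] just before [c]. *)
Lemma path_not_separated (g : R -> Chat) (U W : Chat -> Prop) (s t : R) :
  path_cont g -> d_open chord U -> d_open chord W ->
  (forall x, 0 <= x <= 1 -> U (g x) \/ W (g x)) ->
  (forall x, 0 <= x <= 1 -> U (g x) -> W (g x) -> False) ->
  0 <= s -> s <= t -> t <= 1 -> U (g s) -> W (g t) -> False.
Proof.
  intros Hg HU HW Hc Hdis Hs Hst Ht Us Wt.
  destruct (completeness (fun x => s <= x <= t /\ U (g x))) as [c [Hub Hlub]].
  - exists t. intros x [Hx _]. lra.
  - exists s. split; [lra|exact Us].
  - assert (Hsc : s <= c) by (apply Hub; split; [lra|exact Us]).
    assert (Hct : c <= t) by (apply Hlub; intros x [Hx _]; lra).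
    destruct (Hc c ltac:(lra)) as [Uc|Wc].
    + destruct (Req_dec c t) as [->|Hne]; [apply (Hdis t); auto; lra|].
      destruct (HU _ Uc) as [eps [Heps He]].
      destruct (Hg c ltac:(lra) eps Heps) as [del [Hdel Hd]].
      set (x := c + Rmin (del / 2) (t - c)).
      assert (Hm1 := Rmin_l (del / 2) (t - c)). assert (Hm2 := Rmin_r (del / 2) (t - c)).
      assert (Hm3 : 0 < Rmin (del / 2) (t - c)) by (apply Rmin_glb_lt; lra).
      assert (x <= c); [|unfold x in *; lra]. apply Hub. unfold x. split; [lra|].
      apply He, Hd; [lra|]. apply Rabs_def1; lra.
    + destruct (HW _ Wc) as [eps [Heps He]].
      destruct (Hg c ltac:(lra) eps Heps) as [del [Hdel Hd]].
      assert (c <= c - del / 2); [|lra]. apply Hlub. intros x [Hx Ux].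
      apply Rnot_lt_le. intros Hlt.
      assert (x <= c) by (apply Hub; split; assumption).
      apply (Hdis x); [lra|exact Ux|]. apply He, Hd; [lra|]. apply Rabs_def1; lra.
Qed.

Lemma path_connected (g : R -> Chat) : path_cont g ->
  d_connected chord (fun a => exists t, 0 <= t <= 1 /\ g t = a).
Proof.
  intros Hg [U [W [HU [HW [Hcov [[a [[s [Hs <-]] Us]] [[b [[t [Ht <-]] Wt]] Hdis]]]]]]].
  destruct (Rle_lt_dec s t) as [Hst|Hst].
  - apply (path_not_separated g U W s t); auto; try lra.
    + intros x Hx. apply Hcov. exists x. auto.
    + intros x Hx. apply Hdis. exists x. auto.
  - apply (path_not_separated g W U t s); auto; try lra.
    + intros x Hx. apply or_comm, Hcov. exists x. auto.
    + intros x Hx H1 H2. apply (Hdis (g x)); auto. exists x. auto.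
Qed.

(** The union of [P] and [B] is connected because both contain [x], so maximality of the component
    swallows [B]. *)
Lemma component_absorbs {X : Type} (d : X -> X -> R) (S P B : X -> Prop) (x : X) :
  d_component d S P -> d_connected d B -> (forall y, B y -> S y) ->
  P x -> B x -> forall y, B y -> P y.
Proof.
  intros [_ [HPS [HPc Hmax]]] HB HBS Px Bx y By.
  apply (Hmax (fun z => P z \/ B z)).
  - intros [U [W [HU [HW [Hcov [[a [Ha Ua]] [[b [Hb Wb]] Hdis]]]]]]].
    assert (HP : forall s t, P s -> P t -> U s -> W t -> False).
    { intros s t Ps Pt Us Wt. apply HPc. exists U, W. repeat split; auto.
      - exists s; auto.
      - exists t; auto.
      - intros z Pz. apply Hdis. auto. }
    assert (HB' : forall s t, B s -> B t -> U s -> W t -> False).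
    { intros s t Ps Pt Us Wt. apply HB. exists U, W. repeat split; auto.
      - exists s; auto.
      - exists t; auto.
      - intros z Pz. apply Hdis. auto. }
    destruct (Hcov x (or_introl Px)) as [Ux|Wx].
    + destruct Hb as [Pb|Bb]; eauto.
    + destruct Ha as [Pa|Ba]; eauto.
  - auto.
  - intros z [Pz|Bz]; auto.
  - auto.
Qed.

Lemma component_path (S P : Chat -> Prop) (g : R -> Chat) (s t : R) :
  d_component chord S P -> path_cont g -> (forall x, 0 <= x <= 1 -> S (g x)) ->
  0 <= s <= 1 -> 0 <= t <= 1 -> P (g s) -> P (g t).
Proof.
  intros HP Hg HS Hs Ht Ps.
  apply (component_absorbs chord S P (fun a => exists t, 0 <= t <= 1 /\ g t = a) (g s)); auto.
  - apply path_connected; exact Hg.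
  - intros y [x [Hx <-]]. auto.
  - exists s; auto.
  - exists t; auto.
Qed.

Lemma segment_path_cont (p q : C) : path_cont (fun t => Some (p + t * (q - p))%C).
Proof.
  intros t Ht eps Heps. assert (Hq := Cmod_ge_0 (q - p)).
  exists (eps / (2 * (Cmod (q - p) + 1))). split; [apply Rdiv_lt_0_compat; lra|].
  intros t' Ht' Hd. eapply Rle_lt_trans; [apply chord_le_Cmod|].
  replace (p + t * (q - p) - (p + t' * (q - p)))%C with (RtoC (t - t') * (q - p))%C
    by (rewrite RtoC_minus; ring).
  rewrite Cmod_mult, Cmod_R, Rabs_minus_sym.
  apply Rlt_div_r in Hd; [|lra]. assert (H0 := Rabs_pos (t' - t)). nra.
Qed.

(** The radial half-line beyond [q], from infinity at [t = 0] to [q] at [t = 1]; the parameter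
    [1 / t] makes it continuous at infinity for the chordal metric. *)
Definition ray (q : C) (t : R) : Chat :=
  if Req_EM_T t 0 then None else Some (q * / RtoC t)%C.

Lemma ray_path_cont (q : C) : 0 < Cmod q -> path_cont (ray q).
Proof.
  intros Hq t Ht eps Heps. destruct (Req_dec t 0) as [->|Hne].
  - exists (eps * Cmod q / 2). split; [nra|]. intros t' Ht' Hd.
    rewrite Rminus_0_r, Rabs_pos_eq in Hd by lra. unfold ray.
    destruct (Req_EM_T 0 0) as [_|]; [|lra].
    destruct (Req_EM_T t' 0) as [_|Hne']; [simpl; lra|]. unfold chord.
    destruct (sqrt_1_sqr_bounds _ (Cmod_ge_0 (q * / RtoC t'))) as [[H1 _] H2].
    rewrite Cmod_mult, Cmod_inv, Cmod_R, Rabs_pos_eq in *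
      by first [lra | intros E; apply RtoC_inj in E; lra].
    eapply Rle_lt_trans.
    { apply Rmult_le_compat_l; [lra|]. apply Rinv_le_contravar; [|exact H2].
      apply Rmult_lt_0_compat; [exact Hq|]. apply Rinv_0_lt_compat; lra. }
    replace (2 * / (Cmod q * / t')) with (2 * t' / Cmod q) by (field; lra).
    apply Rlt_div_l; lra.
  - assert (Hdel : 0 < eps * t ^ 2 / (4 * Cmod q)) by
      (apply Rdiv_lt_0_compat; [apply Rmult_lt_0_compat; [lra|apply pow_lt; lra]|lra]).
    exists (Rmin (t / 2) (eps * t ^ 2 / (4 * Cmod q))). split; [apply Rmin_glb_lt; lra|].
    intros t' Ht' Hd.
    assert (Hd1 : Rabs (t' - t) < t / 2) by (eapply Rlt_le_trans; [exact Hd|apply Rmin_l]).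
    assert (Hd2 : Rabs (t' - t) < eps * t ^ 2 / (4 * Cmod q))
      by (eapply Rlt_le_trans; [exact Hd|apply Rmin_r]).
    assert (Ht2 : t / 2 < t') by (apply Rabs_def2 in Hd1; lra).
    unfold ray. destruct (Req_EM_T t 0) as [|_]; [lra|].
    destruct (Req_EM_T t' 0) as [|_]; [lra|].
    eapply Rle_lt_trans; [apply chord_le_Cmod|].
    assert (N1 : RtoC t <> 0) by (intros E; apply RtoC_inj in E; lra).
    assert (N2 : RtoC t' <> 0) by (intros E; apply RtoC_inj in E; lra).
    replace (q * / t - q * / t')%C with (q * RtoC (t' - t) * / RtoC t * / RtoC t')%C
      by (rewrite RtoC_minus; field; split; assumption).
    rewrite !Cmod_mult, !Cmod_inv, !Cmod_R, (Rabs_pos_eq t), (Rabs_pos_eq t') by (assumption || lra).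
    apply Rlt_div_r in Hd2; [|lra].
    apply Rmult_lt_reg_r with (t * t'); [nra|].
    replace (2 * (Cmod q * Rabs (t' - t) * / t * / t') * (t * t'))
      with (2 * Cmod q * Rabs (t' - t)) by (field; lra).
    assert (0 < eps * t) by nra. nra.
Qed.

Lemma component_segment (O : C -> Prop) (P : Chat -> Prop) (p q : C) (s t : R) :
  d_component chord (ext_set O) P ->
  0 <= s <= 1 -> 0 <= t <= 1 ->
  (forall x, 0 <= x <= 1 -> ~ d_closure cdist O (p + RtoC x * (q - p))%C) ->
  P (Some (p + RtoC s * (q - p))%C) -> P (Some (p + RtoC t * (q - p))%C).
Proof.
  intros HP Hs Ht HO Ps.
  apply (component_path (ext_set O) P (fun t => Some (p + t * (q - p))%C) s t); auto.
  - apply segment_path_cont.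
  - intros x Hx. apply ext_set_Some. auto.
Qed.

(** The outward ray from [q] stays outside the disc of radius [M], hence in the exterior of [O], so
    a component contains both its ends or neither. *)
Lemma component_exterior (O : C -> Prop) (P : Chat -> Prop) (M : R) (q : C) :
  (forall z, O z -> Cmod z <= M) -> 0 <= M -> M < Cmod q ->
  d_component chord (ext_set O) P -> (P None <-> P (Some q)).
Proof.
  intros HM HM0 Hq HP.
  assert (Hg : forall s t, 0 <= s <= 1 -> 0 <= t <= 1 -> P (ray q s) -> P (ray q t)).
  { intros s t Hs Ht. apply (component_path (ext_set O) P); auto.
    - apply ray_path_cont. lra.
    - intros x Hx. unfold ray. destruct (Req_EM_T x 0) as [_|Hne].
      + apply ext_set_None with M; auto.
      + apply ext_set_Some. intros H. apply (closure_Cmod_le O M) in H; [|exact HM].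
        rewrite Cmod_mult, Cmod_inv, Cmod_R, Rabs_pos_eq in H
          by first [lra | intros E; apply RtoC_inj in E; lra].
        assert (1 <= / x) by (rewrite <- Rinv_1; apply Rinv_le_contravar; lra). nra. }
  assert (E0 : ray q 0 = None) by (unfold ray; destruct (Req_EM_T 0 0); [reflexivity|lra]).
  assert (E1 : ray q 1 = Some q).
  { unfold ray; destruct (Req_EM_T 1 0); [lra|]. f_equal. field. }
  split; intros H.
  - rewrite <- E1. apply (Hg 0 1); [lra|lra|]. rewrite E0. exact H.
  - rewrite <- E0. apply (Hg 1 0); [lra|lra|]. rewrite E1. exact H.
Qed.

(* A neighbourhood of an exterior point is connected (this includes infinity), so a
   boundary point of a complementary component cannot be an exterior point. *)
Lemma boundary_of_component (O : C -> Prop) (P : Chat -> Prop) (M : R) (a : Chat) :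
  (forall z, O z -> Cmod z <= M) -> 0 <= M -> d_component chord (ext_set O) P ->
  d_closure chord P a -> d_closure chord (Omij P) a ->
  exists p, a = Some p /\ d_closure cdist O p.
Proof.
  intros HM HM0 HP HcP HcW.
  assert (HW : forall y, P y -> Omij P y -> False).
  { intros y Py Wy. apply Wy. intros eps Heps. exists y. rewrite chord_refl. auto. }
  destruct a as [p|].
  - exists p. split; [reflexivity|]. apply NNPP. intros Hn.
    assert (Hr : exists rho, 0 < rho /\ forall y, O y -> rho <= cdist p y).
    { apply NNPP. intros H. apply Hn. intros eps Heps. apply NNPP. intros H'.
      apply H. exists eps. split; [exact Heps|]. intros y Oy. apply Rnot_lt_le.
      intros Hlt. apply H'. exists y. auto. }
    destruct Hr as [rho [Hrho Hr]].
    destruct (chord_near_finite p rho Hrho) as [eps [Heps He]].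
    destruct (HcP eps Heps) as [y [Py Hy]]. destruct (He y Hy) as [q [-> Hq]].
    destruct (HcW eps Heps) as [y' [Wy Hy']]. destruct (He y' Hy') as [q' [-> Hq']].
    apply (HW (Some q')); [|exact Wy].
    replace q' with (q + RtoC 1 * (q' - q))%C by ring.
    apply (component_segment O P q q' 0 1); [exact HP|lra|lra| |].
    + intros x Hx Hcl.
      assert (Hpx : Cmod (p - (q + RtoC x * (q' - q))) < rho).
      { replace (p - (q + x * (q' - q)))%C
          with (RtoC (1 - x) * (p - q) + RtoC x * (p - q'))%C by (rewrite RtoC_minus; ring).
        eapply Rle_lt_trans; [apply Cmod_triangle|].
        rewrite !Cmod_mult, !Cmod_R, !Rabs_pos_eq by lra.
        destruct (Req_dec x 0) as [->|]; [lra|]. nra. }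
      destruct (Hcl (rho - Cmod (p - (q + RtoC x * (q' - q)))) ltac:(lra)) as [y [Oy Hd]].
      assert (Hy2 := Hr y Oy). unfold cdist in *.
      generalize (Cmod_minus_triangle p (q + RtoC x * (q' - q)) y). lra.
    + replace (q + RtoC 0 * (q' - q))%C with q by ring. exact Py.
  - exfalso. destruct (chord_near_infinity M HM0) as [eps [Heps He]].
    destruct (HcP eps Heps) as [y [Py Hy]]. destruct (HcW eps Heps) as [y' [Wy Hy']].
    assert (PN : P None).
    { destruct (He y Hy) as [->|[q [-> Hq]]]; [exact Py|].
      apply (component_exterior O P M q); auto. }
    apply (HW y'); [|exact Wy].
    destruct (He y' Hy') as [->|[q [-> Hq]]]; [exact PN|].
    apply (component_exterior O P M q); auto.
Qed.

(** * Riemann maps on the unit circle and nearest points *)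

(** The open disc already covers [W], so by injectivity no point of the circle can land there. *)
Lemma riemann_map_circle (W : Chat -> Prop) (phi : C -> Chat) (z : C) :
  riemann_map W phi -> Cmod z <= 1 -> (Cmod z = 1 <-> ~ W (phi z)).
Proof.
  intros [_ [_ [Hinj [_ [_ [Hin [Hon _]]]]]]] Hz. split.
  - intros H1 HW. destruct (Hon _ HW) as [z' [Hz' E]].
    apply Hinj in E; [subst; lra|lra|lra].
  - intros HW. apply NNPP. intros Hne. apply HW, Hin. lra.
Qed.

(** A point of the circle is sent outside [Omij P], that is into the closure of [P], yet stays in
    the closure of [Omij P]; [boundary_of_component] then applies. In particular the value is
    finite, so the default of [toC] never interferes on the torus. *)
Lemma riemann_map_boundary (O : C -> Prop) (P : Chat -> Prop) (M : R) (phi : C -> Chat) (z : C) :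
  (forall z, O z -> Cmod z <= M) -> 0 <= M -> d_component chord (ext_set O) P ->
  riemann_map (Omij P) phi -> Cmod z = 1 ->
  phi z = Some (toC (phi z)) /\ d_closure cdist O (toC (phi z)) /\ d_closure chord P (phi z).
Proof.
  intros HM HM0 HP Hphi Hz.
  assert (H1 := proj1 (riemann_map_circle _ _ z Hphi ltac:(lra)) Hz).
  apply NNPP in H1.
  destruct (boundary_of_component O P M (phi z)) as [p [E Hp]]; auto.
  { apply (proj1 Hphi). lra. }
  rewrite E in *. auto.
Qed.

Lemma closed_nearest_point (O : C -> Prop) (M : R) (p : C) :
  (exists z, O z) -> (forall z, O z -> Cmod z <= M) ->
  exists b, d_closure cdist O b /\ forall y, d_closure cdist O y -> Cmod (p - b) <= Cmod (p - y).
Proof.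
  intros [z0 Hz0] HM.
  (* Distances are negated because [completeness] yields suprema: the infimum of the distances is
     [- m]. *)
  destruct (completeness (fun r => exists y, O y /\ r = - Cmod (p - y))) as [m [Hub Hlub]].
  { exists 0. intros r [y [_ ->]]. generalize (Cmod_ge_0 (p - y)). lra. }
  { exists (- Cmod (p - z0)), z0. auto. }
  assert (Hseq : forall n : nat, exists y, O y /\ Cmod (p - y) < - m + / (INR n + 1)).
  { intros n. apply NNPP. intros H.
    assert (0 < / (INR n + 1)) by (apply Rinv_0_lt_compat; generalize (pos_INR n); lra).
    assert (m <= m - / (INR n + 1)); [|lra]. apply Hlub. intros r [y [Oy ->]].
    apply Rnot_lt_le. intros Hlt. apply H. exists y. split; [exact Oy|lra]. }
  set (y := fun n => proj1_sig (constructive_indefinite_description _ (Hseq n))).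
  assert (Hy : forall n, O (y n) /\ Cmod (p - y n) < - m + / (INR n + 1)).
  { intros n. apply (proj2_sig (constructive_indefinite_description _ (Hseq n))). }
  clearbody y.
  destruct (C_cluster_point y M) as [b Hb]. { intros n. apply HM, Hy. }
  exists b. split.
  - intros eps Heps. destruct (Hb eps 0%nat Heps) as [n [_ Hn]]. exists (y n).
    split; [apply Hy|]. unfold cdist. rewrite Cmod_minus_sym. exact Hn.
  - intros w Hw. apply (le_of_le_plus_eps_mult _ _ 3). intros eps Heps.
    destruct (Hw eps Heps) as [w' [Ow' Hw']]. unfold cdist in Hw'.
    assert (H1 : - Cmod (p - w') <= m) by (apply Hub; exists w'; auto).
    destruct (archimed_cor1 eps Heps) as [N [HN HN0]].
    destruct (Hb eps N Heps) as [n [Hn Hnb]].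
    destruct (Hy n) as [_ Hyn].
    assert (/ (INR n + 1) < eps).
    { eapply Rle_lt_trans; [|exact HN]. apply Rinv_le_contravar; [apply lt_0_INR; lia|].
      apply le_INR in Hn. lra. }
    generalize (Cmod_minus_triangle p (y n) b) (Cmod_minus_triangle p w w'). lra.
Qed.

(** * Boundary bumps *)

Lemma cexpi_mod (t : R) : Cmod (cexpi t) = 1.
Proof.
  assert (H : Cmod (cexpi t) ^ 2 = 1).
  { rewrite Cmod2_alt. unfold cexpi. simpl Re. simpl Im.
    generalize (sin2_cos2 t). unfold Rsqr. unfold Re, Im; simpl. lra. }
  generalize (Cmod_ge_0 (cexpi t)). nra.
Qed.

Lemma cexpi_plus (a b : R) : cexpi (a + b) = (cexpi a * cexpi b)%C.
Proof.
  unfold cexpi, Cmult. simpl. rewrite cos_plus, sin_plus. f_equal; ring.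
Qed.

Lemma cexpi_reduce (t : R) : exists t', 0 <= t' <= 2 * PI /\ cexpi t' = cexpi t.
Proof.
  assert (HP := PI_RGT_0).
  assert (H : forall N : nat, forall t, Rabs t <= INR N * (2 * PI) ->
    exists t', 0 <= t' <= 2 * PI /\ cexpi t' = cexpi t).
  { induction N as [|N IH]; intros s Hs.
    - simpl in Hs. rewrite Rmult_0_l in Hs. exists s. apply Rabs_le_between in Hs.
      split; [lra|reflexivity].
    - rewrite S_INR in Hs.
      destruct (Rle_lt_dec s 0) as [H0|H0]; [|destruct (Rle_lt_dec s (2 * PI)) as [H1|H1]].
      + destruct (Req_dec s 0) as [->|Hne]; [exists 0; split; [lra|reflexivity]|].
        rewrite Rabs_left in Hs by lra.
        destruct (Rle_lt_dec (- (2 * PI)) s) as [H2|H2].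
        * exists (s + 2 * PI). split; [lra|]. unfold cexpi.
          rewrite cos_plus, sin_plus, cos_2PI, sin_2PI. f_equal; ring.
        * destruct (IH (s + 2 * PI)) as [t' [Ht' E]]; [rewrite Rabs_left by lra; lra|].
          exists t'. split; [exact Ht'|]. rewrite E. unfold cexpi.
          rewrite cos_plus, sin_plus, cos_2PI, sin_2PI. f_equal; ring.
      + exists s. split; [lra|reflexivity].
      + rewrite Rabs_pos_eq in Hs by lra.
        destruct (IH (s - 2 * PI)) as [t' [Ht' E]]; [rewrite Rabs_pos_eq by lra; lra|].
        exists t'. split; [exact Ht'|]. rewrite E. unfold cexpi.
        rewrite cos_minus, sin_minus, cos_2PI, sin_2PI. f_equal; ring. }
  destruct (INR_unbounded (Rabs t / (2 * PI))) as [N HN].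
  apply (H N). apply Rlt_le. apply Rlt_div_l in HN; lra.
Qed.

Lemma cexpi_inj (a b : R) : 0 <= a < 2 * PI -> 0 <= b < 2 * PI -> cexpi a = cexpi b -> a = b.
Proof.
  assert (H : forall a b, 0 <= a -> a < b -> b < 2 * PI -> cexpi a = cexpi b -> False).
  { clear. intros a b Ha Hab Hb E. injection E as E1 E2.
    assert (Hc : cos (b - a) = 1).
    { rewrite cos_minus, E1, E2. generalize (sin2_cos2 b). unfold Rsqr. lra. }
    assert (Hs : 0 < sin ((b - a) / 2)) by (apply sin_gt_0; lra).
    replace (b - a) with (2 * ((b - a) / 2)) in Hc by field.
    rewrite cos_2a_sin in Hc. nra. }
  intros Ha Hb E. destruct (Rtotal_order a b) as [L|[L|L]]; [|exact L|]; exfalso.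
  - apply (H a b); auto; lra.
  - apply (H b a); auto; lra.
Qed.

(** A local continuous inverse of the parametrisation: after rotation by [- b] the point [(x, y)] is
    near 1 and its argument is [atan (y / x)]. The bound [1 / 2] gives [x > 1 / 2], whence
    [|y / x| < del]. *)
Lemma cexpi_near (b eps : R) : 0 < eps -> exists eta, 0 < eta /\
  forall z, Cmod z = 1 -> Cmod (z - cexpi b) < eta ->
    exists a, z = cexpi a /\ Rabs (a - b) < eps.
Proof.
  intros Heps.
  destruct (proj1 (continuity_pt_locally atan 0)
    (derivable_continuous_pt _ _ (derivable_pt_atan 0)) (mkposreal eps Heps)) as [[del Hdel] Hd].
  simpl in Hd.
  exists (Rmin (1 / 2) (del / 2)). split; [apply Rmin_glb_lt; lra|].
  intros z Hz Hlt.
  assert (Hl1 : Cmod (z - cexpi b) < 1 / 2) by (eapply Rlt_le_trans; [exact Hlt|apply Rmin_l]).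
  assert (Hl2 : Cmod (z - cexpi b) < del / 2) by (eapply Rlt_le_trans; [exact Hlt|apply Rmin_r]).
  set (u := (z * cexpi (- b))%C).
  assert (Hu1 : Cmod u = 1) by (unfold u; rewrite Cmod_mult, Hz, cexpi_mod; ring).
  assert (Hbb : (cexpi b * cexpi (- b))%C = RtoC 1).
  { rewrite <- cexpi_plus. replace (b + - b) with 0 by ring. unfold cexpi.
    rewrite cos_0, sin_0. reflexivity. }
  assert (Hum : Cmod (u - 1) = Cmod (z - cexpi b)).
  { unfold u. rewrite <- Hbb. replace (z * cexpi (- b) - cexpi b * cexpi (- b))%C
      with ((z - cexpi b) * cexpi (- b))%C by ring. rewrite Cmod_mult, cexpi_mod. ring. }
  assert (Hzu : z = (cexpi b * u)%C).
  { unfold u. replace (cexpi b * (z * cexpi (- b)))%C with (z * (cexpi b * cexpi (- b)))%C by ring.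
    rewrite Hbb. ring. }
  clearbody u. destruct u as [x y].
  assert (Hx := re_le_Cmod ((x, y) - 1)). assert (Hy := Im_le_Cmod ((x, y) - 1)).
  rewrite Hum in Hx, Hy. unfold Re, Im in Hx, Hy. simpl in Hx, Hy.
  assert (Hn : x * x + y * y = 1).
  { assert (E := Cmod2_alt (x, y)). rewrite Hu1 in E. unfold Re, Im in E; simpl in E. lra. }
  assert (Hxp : 1 / 2 < x).
  { assert (H := Rle_lt_trans _ _ _ Hx Hl1). apply Rabs_def2 in H. lra. }
  assert (Hyx : Rabs (y / x) < del).
  { unfold Rdiv. rewrite Rabs_mult, (Rabs_pos_eq (/ x)) by (left; apply Rinv_0_lt_compat; lra).
    apply (Rlt_div_l (Rabs y) del x); [lra|]. replace (y + - 0) with y in Hy by ring.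
    nra. }
  assert (Hs : sqrt (1 + (y / x)²) = / x).
  { replace (1 + (y / x)²) with ((/ x) ^ 2).
    - apply sqrt_pow2. left. apply Rinv_0_lt_compat. lra.
    - unfold Rsqr. apply Rmult_eq_reg_r with (x * x); [|nra].
      replace ((/ x) ^ 2 * (x * x)) with 1 by (field; lra).
      replace ((1 + y / x * (y / x)) * (x * x)) with (x * x + y * y) by (field; lra). lra. }
  exists (b + atan (y / x)). split.
  - rewrite cexpi_plus, Hzu. f_equal. unfold cexpi. rewrite cos_atan, sin_atan, Hs.
    f_equal; field; lra.
  - replace (b + atan (y / x) - b) with (atan (y / x) - atan 0) by (rewrite atan_0; ring).
    apply Hd. unfold ball; simpl. unfold AbsRing_ball, abs, minus, plus, opp; simpl.
    replace (y / x + - 0) with (y / x) by ring. exact Hyx.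
Qed.

(** The data of a single complementary component; up to the oscillating functions the product plays
    no part. *)
Definition hole (O : C -> Prop) (P : Chat -> Prop) (phi : C -> Chat) : Prop :=
  (exists z, O z) /\ d_open cdist O /\ (exists M, 0 <= M /\ forall z, O z -> Cmod z <= M) /\
  d_component chord (ext_set O) P /\ riemann_map (Omij P) phi.

Lemma hole_boundary O P phi z : hole O P phi -> Cmod z = 1 ->
  phi z = Some (toC (phi z)) /\ d_closure cdist O (toC (phi z)) /\ d_closure chord P (phi z).
Proof.
  intros [_ [_ [[M [HM0 HM]] [HP Hphi]]]] Hz. apply riemann_map_boundary with M; auto.
Qed.

Lemma hole_continuous O P phi z eps : hole O P phi -> Cmod z = 1 -> 0 < eps ->
  exists del, 0 < del /\ forall w, Cmod w = 1 -> Cmod (w - z) < del ->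
    Cmod (toC (phi w) - toC (phi z)) < eps.
Proof.
  intros HH Hz Heps. assert (HH' := HH). destruct HH' as [_ [_ [[M [HM0 HM]] [_ Hphi]]]].
  destruct Hphi as [_ [_ [_ [Hc _]]]].
  assert (HMp : 0 < (1 + M) ^ 2) by (apply pow_lt; lra).
  destruct (Hc z ltac:(lra) (eps / (1 + M) ^ 2)) as [del [Hdel Hd]].
  { apply Rdiv_lt_0_compat; lra. }
  exists del. split; [exact Hdel|]. intros w Hw Hlt.
  destruct (hole_boundary O P phi z HH Hz) as [E1 [C1 _]].
  destruct (hole_boundary O P phi w HH Hw) as [E2 [C2 _]].
  assert (Hch := Hd w ltac:(lra)). unfold cdist in Hch. rewrite Cmod_minus_sym in Hch.
  specialize (Hch Hlt). rewrite E1, E2 in Hch.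
  rewrite Cmod_minus_sym. eapply Rle_lt_trans.
  { apply (Cmod_le_chord M); eapply closure_Cmod_le; eauto. }
  apply Rlt_div_r in Hch; [|exact HMp]. lra.
Qed.

Lemma hole_injective O P phi z w : hole O P phi -> Cmod z = 1 -> Cmod w = 1 ->
  toC (phi z) = toC (phi w) -> z = w.
Proof.
  intros HH Hz Hw E.
  destruct (hole_boundary O P phi z HH Hz) as [E1 _].
  destruct (hole_boundary O P phi w HH Hw) as [E2 _].
  destruct HH as [_ [_ [_ [_ [_ [_ [Hinj _]]]]]]]. apply Hinj; [lra|lra|]. congruence.
Qed.

(** [O] itself lies in [Omij P]: it is open and [P] is contained in its exterior, so no point of [O]
    is a limit of points of [P]. *)
Lemma closure_Omij O P phi b : hole O P phi -> d_closure cdist O b ->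
  d_closure chord (Omij P) (Some b).
Proof.
  intros [_ [HO [_ [[_ [HPS _]] _]]]] Hb eps Heps.
  destruct (Hb (eps / 2) ltac:(lra)) as [y [Oy Hy]]. unfold cdist in Hy.
  exists (Some y). split.
  - intros Hcl. destruct (HO y Oy) as [rho [Hrho Hr]].
    destruct (chord_near_finite y rho Hrho) as [e' [He' Hn]].
    destruct (Hcl e' He') as [a [Pa Ha]]. destruct (Hn a Ha) as [q [-> Hq]].
    apply HPS, ext_set_Some in Pa. apply Pa. intros e Hepos. exists q.
    split; [apply Hr, Hq|]. unfold cdist. replace (q - q)%C with (RtoC 0) by ring.
    rewrite Cmod_0. exact Hepos.
  - eapply Rle_lt_trans; [apply chord_le_Cmod|]. lra.
Qed.

(* A point of the closure of [O] nearest to [p] in the hole lies on the boundary curve,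
   because the segment joining it to [p] stays in the hole. *)
Lemma nearest_on_curve O P phi p b : hole O P phi -> P (Some p) ->
  d_closure cdist O b ->
  (forall y, d_closure cdist O y -> Cmod (p - b) <= Cmod (p - y)) ->
  exists z, Cmod z = 1 /\ phi z = Some b.
Proof.
  intros HH Pp Hb Hmin.
  assert (HbP : d_closure chord P (Some b)).
  { intros eps Heps. assert (H0 := Cmod_ge_0 (p - b)).
    set (d := Cmod (p - b)) in *.
    (* The fraction of the segment left before [b]; the resulting chordal error is at most
       [2 * s * d], below [eps]. *)
    set (s := Rmin (1 / 2) (eps / (4 * (d + 1)))).
    assert (Hs0 : 0 < s) by (apply Rmin_glb_lt; [lra|]; apply Rdiv_lt_0_compat; lra).
    assert (Hs1 : s <= 1 / 2) by apply Rmin_l.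
    assert (Hs2 : s <= eps / (4 * (d + 1))) by apply Rmin_r.
    apply Rle_div_r in Hs2; [|lra].
    exists (Some (p + RtoC (1 - s) * (b - p))%C). split.
    - set (q := (p + RtoC (1 - s) * (b - p))%C).
      replace q with (p + RtoC 1 * (q - p))%C by ring.
      apply (component_segment O P p q 0 1); [apply HH|lra|lra| |].
      (* A point of the closure on the truncated segment would be strictly closer to [p] than [b]
         is. *)
      + intros x Hx Hcl. assert (Hd := Hmin _ Hcl). fold d in Hd.
        replace (p - (p + RtoC x * (q - p)))%C with (RtoC (x * (1 - s)) * (p - b))%C in Hd
          by (unfold q; rewrite RtoC_mult; ring).
        rewrite Cmod_mult, Cmod_R, Rabs_pos_eq in Hd by nra. fold d in Hd.
        assert (Hd0 : d <> 0).
        { intros E. unfold d in E. apply Cmod_eq_0 in E.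
          assert (p = b) by (replace p with (p - b + b)%C by ring; rewrite E; ring).
          subst b. destruct HH as [_ [_ [_ [[_ [HPS _]] _]]]].
          apply HPS, ext_set_Some in Pp. tauto. }
        assert (x * (1 - s) < 1) by nra. nra.
      + replace (p + RtoC 0 * (q - p))%C with p by ring. exact Pp.
    - eapply Rle_lt_trans; [apply chord_le_Cmod|].
      replace (b - (p + RtoC (1 - s) * (b - p)))%C with (RtoC s * (b - p))%C
        by (rewrite RtoC_minus; ring).
      rewrite Cmod_mult, Cmod_R, Rabs_pos_eq, Cmod_minus_sym by lra. fold d. nra. }
  assert (HbW := closure_Omij O P phi b HH Hb).
  destruct HH as [_ [_ [_ [_ Hphi]]]]. assert (Hphi' := Hphi).
  destruct Hphi' as [_ [Hsurj _]]. destruct (Hsurj _ HbW) as [z [Hz E]].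
  exists z. split; [|exact E]. apply (riemann_map_circle (Omij P) phi z Hphi Hz).
  rewrite E. intros H. exact (H HbP).
Qed.

Definition cont_cl (O : C -> Prop) (B : C -> C) : Prop :=
  forall x, d_closure cdist O x -> forall eps, 0 < eps -> exists del, 0 < del /\
    forall y, d_closure cdist O y -> Cmod (y - x) < del -> Cmod (B y - B x) < eps.

Definition bcurve (phi : C -> Chat) (t : R) : C := toC (phi (cexpi t)).

(* The bump is [(b - p) / (x - p)] with [p] in the hole close to the curve and [b] the point
   of the closure of [O] nearest to [p]. *)
Lemma bump O P phi be eta : hole O P phi -> 0 < eta ->
  exists (B : C -> C) (al : R),
    Rabs (al - be) < eta /\ B (bcurve phi al) = RtoC 1 /\
    Cmod (bcurve phi al - bcurve phi be) < eta /\
    (forall x, d_closure cdist O x -> Cmod (B x) <= 1) /\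
    (forall x, d_closure cdist O x -> eta <= Cmod (x - bcurve phi be) -> Cmod (B x) <= eta) /\
    quad_diff O eta B /\ cont_cl O B.
Proof.
  intros HH Heta.
  destruct (hole_boundary O P phi (cexpi be) HH (cexpi_mod be)) as [E0 [C0 CP]].
  fold (bcurve phi be) in *. set (b0 := bcurve phi be) in *.
  destruct (cexpi_near be eta Heta) as [eta1 [Heta1 Hnear]].
  assert (HH' := HH). destruct HH' as [Hne [_ [[M [HM0 HM]] [HP Hphi]]]].
  destruct Hphi as [_ [_ [_ [_ [Hinv _]]]]].
  destruct (Hinv (cexpi be) ltac:(rewrite cexpi_mod; lra) eta1 Heta1) as [del [Hdel Hd]].
  (* [nu] bounds [|b0 - p|], hence [|b - p|], and [|b - b0| < 2 * nu]. At distance [eta] from [b0]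
     one has [|x - p| >= 3/4 * eta], so [eta ^ 2 / 4] makes the quotient at most [eta]; [del / 8]
     lets the continuity of the inverse of [phi] bring the preimage of [b] close to [cexpi be]. *)
  set (nu := Rmin (Rmin (eta / 4) (eta ^ 2 / 4)) (del / 8)).
  assert (Hnu : 0 < nu /\ nu <= eta / 4 /\ nu <= eta ^ 2 / 4 /\ nu <= del / 8).
  { assert (0 < eta ^ 2) by (apply pow_lt; lra).
    assert (A1 := Rmin_l (Rmin (eta / 4) (eta ^ 2 / 4)) (del / 8)).
    assert (A2 := Rmin_r (Rmin (eta / 4) (eta ^ 2 / 4)) (del / 8)).
    assert (A3 := Rmin_l (eta / 4) (eta ^ 2 / 4)). assert (A4 := Rmin_r (eta / 4) (eta ^ 2 / 4)).
    fold nu in A1, A2. repeat split; try lra.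
    unfold nu. repeat apply Rmin_glb_lt; lra. }
  clearbody nu. destruct Hnu as [Hnu0 [Hnu1 [Hnu2 Hnu3]]].
  destruct (chord_near_finite b0 nu Hnu0) as [e1 [He1 Hn1]].
  rewrite E0 in CP. destruct (CP e1 He1) as [a [Pa Ha]].
  destruct (Hn1 a Ha) as [p [-> Hp]].
  assert (Hpcl : ~ d_closure cdist O p).
  { destruct HP as [_ [HPS _]]. apply ext_set_Some, HPS, Pa. }
  destruct (closed_nearest_point O M p Hne HM) as [b [Hb Hmin]].
  destruct (nearest_on_curve O P phi p b HH Pa Hb Hmin) as [z [Hz Ez]].
  assert (Hbp : 0 < Cmod (p - b)).
  { apply Cmod_gt_0. intros E. apply Hpcl.
    replace p with b by (replace p with (p - b + b)%C by ring; rewrite E; ring). exact Hb. }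
  assert (Hbn : Cmod (p - b) <= Cmod (b0 - p)) by (rewrite (Cmod_minus_sym b0); apply Hmin, C0).
  assert (Hbb : Cmod (b0 - b) < 2 * nu) by (generalize (Cmod_minus_triangle b0 p b); lra).
  destruct (Hnear z Hz) as [al [-> Hal]].
  { assert (Hdz := Hd z ltac:(lra)). unfold cdist in Hdz. rewrite Cmod_minus_sym. apply Hdz.
    rewrite E0, Ez. eapply Rle_lt_trans; [apply chord_le_Cmod|]. lra. }
  assert (Eb : bcurve phi al = b) by (unfold bcurve; rewrite Ez; reflexivity).
  assert (Hxp : forall x, d_closure cdist O x -> Cmod (b - p) <= Cmod (x - p)).
  { intros x Hx. rewrite (Cmod_minus_sym b), (Cmod_minus_sym x). apply Hmin, Hx. }
  rewrite (Cmod_minus_sym p b) in Hbp, Hbn.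
  assert (Hxp0 : forall x, d_closure cdist O x -> (x - p)%C <> 0).
  { intros x Hx. apply Cmod_gt_0. generalize (Hxp x Hx). lra. }
  exists (fun x => (b - p) / (x - p))%C, al. rewrite Eb.
  split; [exact Hal|]. split; [field; apply Hxp0, Hb|].
  split; [rewrite Cmod_minus_sym; lra|]. split; [|split; [|split]].
  - intros x Hx. rewrite Cmod_div by (apply Hxp0, Hx). assert (H1 := Hxp x Hx).
    apply Rle_div_l; lra.
  - intros x Hx Hfar. rewrite Cmod_div by (apply Hxp0, Hx). assert (H1 := Hxp x Hx).
    assert (H2 := Cmod_minus_triangle x p b0). rewrite (Cmod_minus_sym p b0) in H2.
    apply Rle_div_l; [lra|]. nra.
  - apply quad_diff_weaken with (Cmod (b - p)); [lra|]. apply quad_diff_simple_pole.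
    intros Op. apply Hpcl. intros e He. exists p. split; [exact Op|].
    unfold cdist. replace (p - p)%C with (RtoC 0) by ring. rewrite Cmod_0. exact He.
  (* Both denominators have modulus at least [|b - p|], so the bump is Lipschitz with constant
     [1 / |b - p|]. *)
  - intros x Hx eps Heps. exists (eps * Cmod (b - p)). split; [nra|].
    intros y Hy Hlt.
    replace ((b - p) / (y - p) - (b - p) / (x - p))%C
      with ((b - p) * (x - y) / ((y - p) * (x - p)))%C by (field; auto).
    rewrite Cmod_div by (apply Cmult_neq_0; auto). rewrite !Cmod_mult, (Cmod_minus_sym x y).
    assert (H1 := Hxp x Hx). assert (H2 := Hxp y Hy). assert (H3 := Cmod_ge_0 (y - x)).
    apply Rlt_div_l; [nra|].
    apply Rlt_le_trans with (Cmod (b - p) * (eps * Cmod (b - p))); [nra|].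
    replace (Cmod (b - p) * (eps * Cmod (b - p))) with (eps * (Cmod (b - p) * Cmod (b - p))) by ring.
    apply Rmult_le_compat_l; [lra|]. apply Rmult_le_compat; lra.
Qed.

Lemma finite_pos_lower_bound (N : nat) (f : nat -> R) : (forall i, (i < N)%nat -> 0 < f i) ->
  exists s, 0 < s /\ forall i, (i < N)%nat -> s <= f i.
Proof.
  intros H. induction N as [|N IH].
  - exists 1. split; [lra|]. intros; lia.
  - destruct IH as [s [Hs Hi]]; [intros; apply H; lia|].
    exists (Rmin s (f N)). split; [apply Rmin_glb_lt; auto|].
    intros i Hi'. destruct (Nat.eq_dec i N) as [->|]; [apply Rmin_r|].
    eapply Rle_trans; [apply Rmin_l|]. apply Hi. lia.
Qed.

Lemma nat_floor (L : nat) (x : R) : (0 < L)%nat -> 0 <= x <= INR L ->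
  exists l, (l < L)%nat /\ INR l <= x <= INR l + 1.
Proof.
  induction L as [|L IH]; [lia|]. intros _ Hx. rewrite S_INR in Hx.
  destruct (Rle_lt_dec (INR L) x) as [H|H]; [exists L; split; [lia|lra]|].
  destruct L as [|L]; [simpl in H; lra|].
  destruct IH as [l [Hl H']]; [lia|lra|]. exists l. split; [lia|exact H'].
Qed.

Lemma cont_cl_const O c : cont_cl O (fun _ => c).
Proof.
  intros x _ eps Heps. exists 1. split; [lra|]. intros y _ _.
  replace (c - c)%C with (RtoC 0) by ring. rewrite Cmod_0. exact Heps.
Qed.

Lemma cont_cl_plus O A B : cont_cl O A -> cont_cl O B -> cont_cl O (fun x => A x + B x)%C.
Proof.
  intros HA HB x Hx eps Heps.
  destruct (HA x Hx (eps / 2) ltac:(lra)) as [d1 [Hd1 H1]].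
  destruct (HB x Hx (eps / 2) ltac:(lra)) as [d2 [Hd2 H2]].
  exists (Rmin d1 d2). split; [apply Rmin_glb_lt; assumption|]. intros y Hy Hlt.
  assert (K1 := H1 y Hy (Rlt_le_trans _ _ _ Hlt (Rmin_l _ _))).
  assert (K2 := H2 y Hy (Rlt_le_trans _ _ _ Hlt (Rmin_r _ _))).
  replace (A y + B y - (A x + B x))%C with ((A y - A x) + (B y - B x))%C by ring.
  eapply Rle_lt_trans; [apply Cmod_triangle|]. lra.
Qed.

(** The centres are [2 * eta] apart, so a point is within [eta] of at most one of them and every
    other bump is at most [eta] there. Hence the sum exceeds one bump by at most [INR m * eta], and
    each peak survives almost intact. *)
Lemma bump_sum O P phi (c : nat -> R) (N : nat) (eta : R) : hole O P phi -> 0 < eta ->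
  (forall l l', (l < N)%nat -> (l' < N)%nat -> l <> l' ->
     2 * eta <= Cmod (bcurve phi (c l) - bcurve phi (c l'))) ->
  forall m, (m <= N)%nat -> exists H : C -> C,
    quad_diff O (INR m * eta) H /\ cont_cl O H /\
    (forall x, d_closure cdist O x -> Cmod (H x) <= 1 + INR m * eta) /\
    (forall x, d_closure cdist O x ->
       (forall l, (l < m)%nat -> eta <= Cmod (x - bcurve phi (c l))) -> Cmod (H x) <= INR m * eta) /\
    (forall l, (l < m)%nat -> exists al, Rabs (al - c l) < eta /\
       Cmod (bcurve phi al - bcurve phi (c l)) < eta /\ 1 - INR m * eta <= Re (H (bcurve phi al))).
Proof.
  intros HH Heta Hsep. induction m as [|m IH]; intros Hm.
  - exists (fun _ => RtoC 0). simpl INR. rewrite Rmult_0_l.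
    split; [apply quad_diff_const|]. split; [apply cont_cl_const|].
    split; [intros; rewrite Cmod_0; lra|]. split; [intros; rewrite Cmod_0; lra|]. intros; lia.
  - destruct (IH ltac:(lia)) as [H [Q [HC [H1 [H2 H3]]]]].
    destruct (bump O P phi (c m) eta HH Heta) as [B [al [A1 [A2 [A3 [B1 [B2 [QB CB]]]]]]]].
    assert (Hcl : forall t, d_closure cdist O (bcurve phi t)).
    { intros t. apply (hole_boundary O P phi (cexpi t) HH (cexpi_mod t)). }
    assert (Hm0 : 0 <= INR m * eta) by (apply Rmult_le_pos; [apply pos_INR|lra]).
    assert (Hnear : forall x l, (l < m)%nat -> Cmod (x - bcurve phi (c m)) < eta ->
      eta <= Cmod (x - bcurve phi (c l))).
    { intros x l Hl Hx. assert (S := Hsep l m ltac:(lia) ltac:(lia) ltac:(lia)).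
      assert (T := Cmod_minus_triangle (bcurve phi (c l)) x (bcurve phi (c m))).
      rewrite (Cmod_minus_sym _ x) in T. lra. }
    exists (fun x => H x + B x)%C. rewrite S_INR, Rmult_plus_distr_r, Rmult_1_l.
    split; [apply quad_diff_plus; assumption|]. split; [apply cont_cl_plus; assumption|].
    split; [|split].
    + intros x Hx. eapply Rle_trans; [apply Cmod_triangle|].
      destruct (Rlt_le_dec (Cmod (x - bcurve phi (c m))) eta) as [Hlt|Hge].
      * assert (K := H2 x Hx (fun l Hl => Hnear x l Hl Hlt)). assert (K' := B1 x Hx). lra.
      * assert (K := H1 x Hx). assert (K' := B2 x Hx Hge). lra.
    + intros x Hx Hfar. eapply Rle_trans; [apply Cmod_triangle|].
      assert (K := H2 x Hx (fun l Hl => Hfar l ltac:(lia))).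
      assert (K' := B2 x Hx (Hfar m ltac:(lia))). lra.
    + intros l Hl. destruct (Nat.eq_dec l m) as [->|Hne].
      * exists al. split; [exact A1|]. split; [exact A3|].
        change (1 - (INR m * eta + eta) <= Re (H (bcurve phi al)) + Re (B (bcurve phi al))).
        rewrite A2. change (Re (RtoC 1)) with 1.
        assert (K := H2 _ (Hcl al) (fun l Hl => Hnear _ l Hl A3)).
        assert (K' := re_le_Cmod (H (bcurve phi al))).
        assert (K'' := Rle_abs (- Re (H (bcurve phi al)))). rewrite Rabs_Ropp in K''. lra.
      * destruct (H3 l ltac:(lia)) as [al' [D1 [D2 D3]]]. exists al'.
        split; [exact D1|]. split; [exact D2|].
        change (1 - (INR m * eta + eta) <= Re (H (bcurve phi al')) + Re (B (bcurve phi al'))).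
        assert (S := Hsep l m ltac:(lia) ltac:(lia) ltac:(lia)).
        assert (T := Cmod_minus_triangle (bcurve phi (c l)) (bcurve phi al') (bcurve phi (c m))).
        rewrite (Cmod_minus_sym _ (bcurve phi al')) in T.
        assert (K := B2 _ (Hcl al') ltac:(lra)).
        assert (K' := re_le_Cmod (B (bcurve phi al'))).
        assert (K'' := Rle_abs (- Re (B (bcurve phi al')))). rewrite Rabs_Ropp in K''. lra.
Qed.

(** On a grid of [2 * L] angles of step [h = PI / L], bumps are placed at the even nodes; the odd
    nodes are far from all of them because the boundary curve is injective. Every angle has a peak
    and a trough within [3 * h < lam]. *)
Lemma oscillating_function O P phi (lam : R) : hole O P phi -> 0 < lam ->
  exists H : C -> C, quad_diff O 1 H /\ cont_cl O H /\
    (forall x, d_closure cdist O x -> Cmod (H x) <= 2) /\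
    forall th, exists a b, Rabs a <= lam /\ Rabs b <= lam /\
      3 / 4 <= Re (H (bcurve phi (th + a))) - Re (H (bcurve phi (th + b))).
Proof.
  intros HH Hlam. assert (HPI := PI_RGT_0).
  destruct (INR_unbounded (Rmax 1 (4 * PI / lam))) as [L HL].
  assert (HL1 : 1 < INR L) by (eapply Rle_lt_trans; [apply Rmax_l|exact HL]).
  assert (HL2 : 4 * PI / lam < INR L) by (eapply Rle_lt_trans; [apply Rmax_r|exact HL]).
  assert (HL0 : (0 < L)%nat) by (destruct L; [simpl in HL1; lra|lia]).
  assert (HLl : 4 * (PI / INR L) < lam).
  { replace (4 * (PI / INR L)) with (4 * PI / INR L) by (field; lra).
    apply Rlt_div_l; [lra|]. apply Rlt_div_l in HL2; lra. }
  set (h := PI / INR L) in *.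
  assert (Hh : 0 < h) by (apply Rdiv_lt_0_compat; lra).
  assert (HhL : h * INR L = PI) by (unfold h; field; lra).
  set (ang := fun i => h * INR i).
  assert (Hang : forall i, (i < 2 * L)%nat -> 0 <= ang i < 2 * PI).
  { intros i Hi. unfold ang. assert (H1 := pos_INR i).
    assert (H2 : INR i < INR (2 * L)) by (apply lt_INR; exact Hi).
    rewrite mult_INR in H2. simpl (INR 2) in H2. nra. }
  assert (Hsep : exists s, 0 < s /\ forall i, (i < 2 * L)%nat -> forall j, (j < 2 * L)%nat ->
    i <> j -> s <= Cmod (bcurve phi (ang i) - bcurve phi (ang j))).
  { assert (Hi : forall i, exists s, 0 < s /\ ((i < 2 * L)%nat -> forall j, (j < 2 * L)%nat ->
      i <> j -> s <= Cmod (bcurve phi (ang i) - bcurve phi (ang j)))).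
    { intros i. destruct (Nat.le_gt_cases (2 * L) i) as [Hi|Hi]; [exists 1; split; [lra|lia]|].
      destruct (finite_pos_lower_bound (2 * L) (fun j => if Nat.eqb i j then 1 else
        Cmod (bcurve phi (ang i) - bcurve phi (ang j)))) as [s [Hs Hj]].
      - intros j Hj. destruct (Nat.eqb_spec i j) as [|Hne]; [lra|].
        apply Cmod_gt_0. intros E. apply Hne.
        assert (E' : bcurve phi (ang i) = bcurve phi (ang j)).
        { replace (bcurve phi (ang i)) with (bcurve phi (ang i) - bcurve phi (ang j)
            + bcurve phi (ang j))%C by ring. rewrite E. ring. }
        apply (hole_injective O P) in E'; auto using cexpi_mod.
        apply cexpi_inj in E'; auto. apply INR_eq.
        apply Rmult_eq_reg_l with h; [exact E'|lra].
      - exists s. split; [exact Hs|]. intros _ j Hj' Hne. assert (K := Hj j Hj'). cbv beta in K.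
        destruct (Nat.eqb_spec i j); [lia|exact K]. }
    set (s := fun i => proj1_sig (constructive_indefinite_description _ (Hi i))).
    assert (Hs := fun i => proj2_sig (constructive_indefinite_description _ (Hi i))).
    cbv beta in Hs. change (forall i, 0 < s i /\ ((i < 2 * L)%nat -> forall j, (j < 2 * L)%nat ->
      i <> j -> s i <= Cmod (bcurve phi (ang i) - bcurve phi (ang j)))) in Hs.
    destruct (finite_pos_lower_bound (2 * L) s) as [s0 [Hs0 Hs0i]]; [intros i _; apply Hs|].
    exists s0. split; [exact Hs0|]. intros i Hi' j Hj Hne.
    eapply Rle_trans; [apply Hs0i, Hi'|]. apply Hs; auto. }
  destruct Hsep as [sg [Hsg Hsep]].
  (* [sg / 2] separates the nodes, [h] keeps each peak near its node, and [/ (8 * INR L)] limits the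
     total error of the [L] bumps to [1 / 8]; thus peaks are at least [7 / 8], troughs at most
     [1 / 8]. *)
  set (eta := Rmin (sg / 2) (Rmin h (/ (8 * INR L)))).
  assert (Hinv : 0 < / (8 * INR L)) by (apply Rinv_0_lt_compat; lra).
  assert (Heta : 0 < eta /\ 2 * eta <= sg /\ eta <= h /\ eta <= / (8 * INR L)).
  { assert (A1 := Rmin_l (sg / 2) (Rmin h (/ (8 * INR L)))).
    assert (A2 := Rmin_r (sg / 2) (Rmin h (/ (8 * INR L)))).
    assert (A3 := Rmin_l h (/ (8 * INR L))). assert (A4 := Rmin_r h (/ (8 * INR L))).
    fold eta in A1, A2. repeat split; try lra. unfold eta. repeat apply Rmin_glb_lt; lra. }
  clearbody eta. destruct Heta as [Heta0 [Heta1 [Heta2 Heta3]]].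
  assert (HLe : INR L * eta <= 1 / 8).
  { apply Rmult_le_compat_l with (r := INR L) in Heta3; [|lra].
    replace (INR L * / (8 * INR L)) with (1 / 8) in Heta3 by (field; lra). exact Heta3. }
  destruct (bump_sum O P phi (fun l => ang (2 * l)%nat) L eta HH Heta0) with (m := L)
    as [H [Q [HC [H1 [H2 H3]]]]].
  { intros l l' Hl Hl' Hne. eapply Rle_trans; [exact Heta1|]. apply Hsep; lia. }
  { lia. }
  exists H. split; [|split; [exact HC|split]].
  - apply quad_diff_weaken with (INR L * eta); [lra|exact Q].
  - intros x Hx. assert (K := H1 x Hx). lra.
  - intros th. destruct (cexpi_reduce th) as [t [Ht E]].
    assert (Eb : forall s, bcurve phi (th + s) = bcurve phi (t + s)).
    { intros s. unfold bcurve. rewrite !cexpi_plus, E. reflexivity. }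
    (* Locates [t] between consecutive even nodes [2 * l] and [2 * l + 2]; the trough is the odd
       node between them. *)
    destruct (nat_floor L (t / (2 * h)) HL0) as [l [Hl Hlt]].
    { split; [apply Rdiv_le_0_compat; lra|]. apply Rle_div_l; lra. }
    assert (Hx : t / (2 * h) * (2 * h) = t) by (field; lra).
    assert (Hl1 : 2 * h * INR l <= t <= 2 * h * INR l + 2 * h) by nra.
    destruct (H3 l Hl) as [al [D1 [D2 D3]]].
    set (be := ang (2 * l + 1)%nat).
    assert (Hb1 : be = 2 * h * INR l + h).
    { unfold be, ang. rewrite plus_INR, mult_INR. simpl. ring. }
    assert (Ha1 : ang (2 * l)%nat = 2 * h * INR l).
    { unfold ang. rewrite mult_INR. simpl. ring. }
    rewrite Ha1 in D1. apply Rabs_def2 in D1.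
    exists (al - t), (be - t). rewrite !Eb.
    replace (t + (al - t)) with al by ring. replace (t + (be - t)) with be by ring.
    split; [apply Rabs_le; lra|]. split; [apply Rabs_le; lra|].
    assert (K : Cmod (H (bcurve phi be)) <= INR L * eta).
    { apply H2.
      - apply (hole_boundary O P phi (cexpi be) HH (cexpi_mod be)).
      - intros l' Hl'. assert (S := Hsep (2 * l + 1)%nat ltac:(lia) (2 * l')%nat ltac:(lia) ltac:(lia)).
        fold be in S. lra. }
    assert (K' := Rle_trans _ _ _ (Rle_abs _) (Rle_trans _ _ _ (re_le_Cmod _) K)). lra.
Qed.

(** * Compactness on the torus *)

Lemma Rabs_sin_le (x : R) : Rabs (sin x) <= Rabs x.
Proof.
  assert (H : forall y, 0 < y -> Rabs (sin y) <= y).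
  { intros y Hy. apply Rabs_le. assert (H1 := sin_lt_x y Hy). split; [|lra].
    destruct (Rle_lt_dec y 1) as [H2|H2].
    - assert (0 <= sin y) by (apply sin_ge_0; generalize PI2_1; lra). lra.
    - generalize (SIN_bound y). lra. }
  destruct (Rtotal_order x 0) as [L|[->|L]].
  - rewrite (Rabs_left x L), <- Rabs_Ropp, <- sin_neg. apply H. lra.
  - rewrite sin_0. lra.
  - rewrite (Rabs_pos_eq x) by lra. apply H, L.
Qed.

Lemma cexpi_lipschitz (a b : R) : Cmod (cexpi a - cexpi b) <= 2 * Rabs (a - b).
Proof.
  eapply Rle_trans; [apply Cmod_le_Re_Im|].
  change (Rabs (cos a - cos b) + Rabs (sin a - sin b) <= 2 * Rabs (a - b)).
  rewrite form2, form4, !Rabs_mult, (Rabs_left (-2)), (Rabs_pos_eq 2) by lra.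
  assert (H := Rabs_sin_le ((a - b) / 2)).
  replace (Rabs ((a - b) / 2)) with (Rabs (a - b) / 2) in H
    by (unfold Rdiv; rewrite Rabs_mult, (Rabs_pos_eq (/ 2)); lra).
  assert (H1 : Rabs (sin ((a + b) / 2)) <= 1) by (apply Rabs_le, SIN_bound).
  assert (H2 : Rabs (cos ((a + b) / 2)) <= 1) by (apply Rabs_le, COS_bound).
  assert (H3 := Rabs_pos (sin ((a - b) / 2))).
  assert (H4 := Rabs_pos (sin ((a + b) / 2))). assert (H5 := Rabs_pos (cos ((a + b) / 2))).
  nra.
Qed.

Lemma expI_in_torus {I : Type} (th : I -> R) : in_torus (expI th).
Proof. intros j. apply cexpi_mod. Qed.

Definition holes {I : Type} (Om : I -> C -> Prop) (k : I -> nat)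
  (V : I -> nat -> Chat -> Prop) (phi : I -> nat -> C -> Chat) : Prop :=
  forall i j, (j < k i)%nat -> hole (Om i) (V i j) (phi i j).

Lemma setting_holes {I : Type} (Om : I -> C -> Prop) k V phi :
  setting Om k V phi -> holes Om k V phi.
Proof.
  intros H i j Hj. destruct (H i) as [[Hne [Hop [_ [M HM]]]] [_ [[Hcomp _] Hphi]]].
  split; [exact Hne|]. split; [exact Hop|]. split; [|split; auto].
  exists (Rmax M 0). split; [apply Rmax_r|]. intros z Hz.
  eapply Rle_trans; [apply HM, Hz|apply Rmax_l].
Qed.

(** The continuity half of [inA]. The compactness arguments use only this, so they apply to the
    partial sums of the series without tracking their holomorphy. *)
Definition cont_on_cl {I : Type} (Om : I -> C -> Prop) (F : (I -> C) -> C) : Prop :=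
  forall x, in_clOm Om x -> prod_cont_at (in_clOm Om) F x.

Lemma phi_r_in_clOm {I : Type} (Om : I -> C -> Prop) k V phi (r : I -> nat) z :
  holes Om k V phi -> (forall i, (r i < k i)%nat) -> in_torus z -> in_clOm Om (phi_r phi r z).
Proof.
  intros HH Hr Hz i. apply (hole_boundary (Om i) (V i (r i)) (phi i (r i)) (z i)); auto.
Qed.

(** Continuity jointly in [r] and [z], each coordinate of [r] being discrete: the finite set of
    coordinates from the product topology is covered by an initial segment of the enumeration
    [e]. *)
Lemma phi_r_continuous {I : Type} (e : nat -> I) (Om : I -> C -> Prop) k V phi F r z eps :
  (forall i, exists m, e m = i) -> holes Om k V phi -> cont_on_cl Om F ->
  (forall i, (r i < k i)%nat) -> in_torus z -> 0 < eps ->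
  exists N del, 0 < del /\ forall r' z', (forall i, (r' i < k i)%nat) -> in_torus z' ->
    (forall m, (m < N)%nat -> r' (e m) = r (e m) /\ Cmod (z' (e m) - z (e m)) < del) ->
    Cmod (F (phi_r phi r' z') - F (phi_r phi r z)) < eps.
Proof.
  intros He HH HF Hr Hz Heps.
  destruct (HF _ (phi_r_in_clOm Om k V phi r z HH Hr Hz) eps Heps) as [Fl [d0 [Hd0 Hc]]].
  assert (HL : exists N del, 0 < del /\ forall r' z', (forall i, (r' i < k i)%nat) -> in_torus z' ->
    (forall m, (m < N)%nat -> r' (e m) = r (e m) /\ Cmod (z' (e m) - z (e m)) < del) ->
    forall i, List.In i Fl -> cdist (phi_r phi r' z' i) (phi_r phi r z i) < d0).
  { clear Hc. induction Fl as [|i Fl IH].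
    - exists 0%nat, 1. split; [lra|]. intros r' z' _ _ _ i [].
    - destruct IH as [N [del [Hdel Hi]]]. destruct (He i) as [m0 Hm0].
      destruct (hole_continuous (Om i) (V i (r i)) (phi i (r i)) (z i) d0) as [d1 [Hd1 H1]]; auto.
      exists (Nat.max N (S m0)), (Rmin del d1). split; [apply Rmin_glb_lt; assumption|].
      intros r' z' Hr' Hz' Hm i' [<-|Hin].
      + destruct (Hm m0 ltac:(lia)) as [E1 E2]. rewrite Hm0 in E1, E2.
        unfold cdist, phi_r. rewrite E1. apply H1; [apply Hz'|].
        eapply Rlt_le_trans; [exact E2|apply Rmin_r].
      + apply (Hi r' z'); auto. intros m Hm'. destruct (Hm m ltac:(lia)) as [E1 E2].
        split; [exact E1|]. eapply Rlt_le_trans; [exact E2|apply Rmin_l]. }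
  destruct HL as [N [del [Hdel HL]]]. exists N, del. split; [exact Hdel|].
  intros r' z' Hr' Hz' Hm. apply Hc; [eapply phi_r_in_clOm; eauto|]. apply (HL r' z'); auto.
Qed.

(** Compactness of the parameter space: [r], [th] and [v] are interleaved modulo 3 into one real
    sequence, to which [cluster_point] applies. *)
Lemma torus_data_cluster {I : Type} (e : nat -> I) (k : I -> nat)
  (r : nat -> I -> nat) (th v : nat -> I -> R) (A B : R) :
  (forall i, exists m, e m = i) ->
  (forall m i, (r m i < k i)%nat) -> (forall m i, Rabs (th m i) <= A) ->
  (forall m i, Rabs (v m i) <= B) ->
  exists r0 th0 v0, (forall i, (r0 i < k i)%nat) /\
    forall N M del, 0 < del -> exists m, (M <= m)%nat /\ forall n, (n < N)%nat ->
      r m (e n) = r0 (e n) /\ Rabs (th m (e n) - th0 (e n)) < del /\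
      Rabs (v m (e n) - v0 (e n)) < del.
Proof.
  intros He Hr Hth Hv.
  set (X := fun m i => match (i mod 3)%nat with
    | 0%nat => INR (r m (e (i / 3)%nat)) | 1%nat => th m (e (i / 3)%nat)
    | _ => v m (e (i / 3)%nat) end).
  destruct (cluster_point X (fun i => Rmax (INR (k (e (i / 3)%nat))) (Rmax A B))) as [x Hx].
  { intros m i. unfold X. destruct (i mod 3)%nat as [|[|n]].
    - eapply Rle_trans; [|apply Rmax_l]. rewrite Rabs_pos_eq by apply pos_INR.
      apply le_INR. specialize (Hr m (e (i / 3)%nat)). lia.
    - eapply Rle_trans; [|apply Rmax_r]. eapply Rle_trans; [|apply Rmax_l]. apply Hth.
    - eapply Rle_trans; [|apply Rmax_r]. eapply Rle_trans; [|apply Rmax_r]. apply Hv. }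
  (* One index is chosen for each element of [I], turning cluster values indexed by naturals into
     functions on [I]. *)
  set (inv := fun i => proj1_sig (constructive_indefinite_description _ (He i))).
  assert (Hinv : forall i, e (inv i) = i)
    by (intros i; apply (proj2_sig (constructive_indefinite_description _ (He i)))).
  clearbody inv.
  assert (X0 : forall m n, X m (3 * n)%nat = INR (r m (e n))).
  { intros m n. unfold X. rewrite <- (Nat.mod_unique (3 * n) 3 n 0) by lia.
    rewrite <- (Nat.div_unique (3 * n) 3 n 0) by lia. reflexivity. }
  assert (X1 : forall m n, X m (3 * n + 1)%nat = th m (e n)).
  { intros m n. unfold X. rewrite <- (Nat.mod_unique (3 * n + 1) 3 n 1) by lia.
    rewrite <- (Nat.div_unique (3 * n + 1) 3 n 1) by lia. reflexivity. }
  assert (X2 : forall m n, X m (3 * n + 2)%nat = v m (e n)).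
  { intros m n. unfold X. rewrite <- (Nat.mod_unique (3 * n + 2) 3 n 2) by lia.
    rewrite <- (Nat.div_unique (3 * n + 2) 3 n 2) by lia. reflexivity. }
  assert (Hr0 : forall i, exists a, (a < k i)%nat /\
    forall n, e n = i -> n = inv i -> Rabs (INR a - x (3 * n)%nat) < 1 / 4).
  { intros i. destruct (Hx (3 * inv i + 1)%nat (1 / 4) 0%nat ltac:(lra)) as [m [_ Hm]].
    exists (r m i). split; [apply Hr|]. intros n En ->.
    specialize (Hm (3 * inv i)%nat ltac:(lia)). rewrite X0, Hinv in Hm. exact Hm. }
  set (r0 := fun i => proj1_sig (constructive_indefinite_description _ (Hr0 i))).
  assert (Hr0' : forall i, (r0 i < k i)%nat /\ Rabs (INR (r0 i) - x (3 * inv i)%nat) < 1 / 4).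
  { intros i. destruct (proj2_sig (constructive_indefinite_description _ (Hr0 i))) as [H1 H2].
    split; [exact H1|]. apply H2; [apply Hinv|reflexivity]. }
  clearbody r0.
  exists r0, (fun i => x (3 * inv i + 1)%nat), (fun i => x (3 * inv i + 2)%nat).
  split; [intros i; apply Hr0'|]. intros N M del Hdel.
  assert (HN : exists N', forall n, (n < N)%nat -> (inv (e n) < N')%nat).
  { clear -N. induction N as [|N [N' IH]]; [exists 0%nat; intros; lia|].
    exists (Nat.max N' (S (inv (e N)))). intros n Hn.
    destruct (Nat.eq_dec n N) as [->|]; [lia|]. specialize (IH n ltac:(lia)). lia. }
  destruct HN as [N' HN'].
  destruct (Hx (3 * N')%nat (Rmin del (1 / 4)) M) as [m [Hm Hi]]; [apply Rmin_glb_lt; lra|].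
  exists m. split; [exact Hm|]. intros n Hn. specialize (HN' n Hn).
  assert (K0 := Hi (3 * inv (e n))%nat ltac:(lia)).
  assert (K1 := Hi (3 * inv (e n) + 1)%nat ltac:(lia)).
  assert (K2 := Hi (3 * inv (e n) + 2)%nat ltac:(lia)).
  rewrite X0, Hinv in K0. rewrite X1, Hinv in K1. rewrite X2, Hinv in K2.
  assert (Q1 := Rmin_l del (1 / 4)). assert (Q2 := Rmin_r del (1 / 4)).
  split; [|split; lra].
  destruct (Hr0' (e n)) as [_ K3].
  (* Two integers within [1 / 4] of the same real number coincide, so closeness of [r] becomes
     equality. *)
  assert (K4 : Rabs (INR (r m (e n)) - INR (r0 (e n))) < 1).
  { apply Rabs_def2 in K3. assert (K5 := Rlt_le_trans _ _ _ K0 Q2). apply Rabs_def2 in K5.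
    apply Rabs_def1; lra. }
  apply Rabs_def2 in K4.
  destruct (Nat.lt_trichotomy (r m (e n)) (r0 (e n))) as [L|[L|L]]; [|exact L|].
  - apply le_INR in L. rewrite S_INR in L. lra.
  - apply le_INR in L. rewrite S_INR in L. lra.
Qed.

(** Bounded angles are what compactness requires. The shift [s] is arbitrary so that one reduced
    [th'] serves for both [th] and [th + t * v]. *)
Lemma angle_reduction {I : Type} (th : I -> R) : exists th',
  (forall i, Rabs (th' i) <= 2 * PI) /\
  forall s : I -> R, expI (fun i => th' i + s i) = expI (fun i => th i + s i).
Proof.
  set (th' := fun i => proj1_sig (constructive_indefinite_description _ (cexpi_reduce (th i)))).
  assert (H : forall i, 0 <= th' i <= 2 * PI /\ cexpi (th' i) = cexpi (th i))
    by (intros i; apply (proj2_sig (constructive_indefinite_description _ (cexpi_reduce (th i))))).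
  exists th'. split.
  - intros i. rewrite Rabs_pos_eq; apply H.
  - intros s. apply functional_extensionality. intros i. unfold expI.
    rewrite !cexpi_plus. f_equal. apply H.
Qed.

Lemma expI_shift0 {I : Type} (th : I -> R) : expI (fun i => th i + 0) = expI th.
Proof. f_equal. apply functional_extensionality. intros i. ring. Qed.

(** Counterexamples with [|t| <= 1 / (m + 1)] would cluster; since [t * v] tends to 0 uniformly,
    both points compared come close to the same [th0], where continuity gives a contradiction. The
    bound is uniform in [r] too. *)
Lemma uniform_continuity_torus {I : Type} (e : nat -> I) (Om : I -> C -> Prop) k V phi F (q eps : R) :
  (forall i, exists m, e m = i) -> holes Om k V phi -> cont_on_cl Om F -> 0 < q -> 0 < eps ->
  exists tau, 0 < tau /\ forall r th v t, (forall i, (r i < k i)%nat) ->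
    (forall i, Rabs (v i) <= q) -> Rabs t <= tau ->
    Cmod (F (phi_r phi r (expI (fun i => th i + t * v i))) - F (phi_r phi r (expI th))) <= eps.
Proof.
  intros He HH HF Hq Heps. apply NNPP. intros Hno.
  assert (Hseq : forall m : nat, exists d : (I -> nat) * (I -> R) * (I -> R) * R,
    let '(r, th, v, t) := d in (forall i, (r i < k i)%nat) /\ (forall i, Rabs (th i) <= 2 * PI) /\
      (forall i, Rabs (v i) <= q) /\ Rabs t <= / (INR m + 1) /\
      eps < Cmod (F (phi_r phi r (expI (fun i => th i + t * v i))) - F (phi_r phi r (expI th)))).
  { intros m. apply NNPP. intros H. apply Hno. exists (/ (INR m + 1)).
    split; [apply Rinv_0_lt_compat; generalize (pos_INR m); lra|].
    intros r th v t Hr Hv Ht. apply Rnot_lt_le. intros Hlt. apply H.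
    destruct (angle_reduction th) as [th' [Hb E]].
    exists (r, th', v, t). split; [exact Hr|]. split; [exact Hb|]. split; [exact Hv|].
    split; [exact Ht|]. rewrite (E (fun i => t * v i)), <- (expI_shift0 th'), (E (fun _ => 0)), expI_shift0.
    exact Hlt. }
  set (d := fun m => proj1_sig (constructive_indefinite_description _ (Hseq m))).
  assert (Hd : forall m, let '(r, th, v, t) := d m in
      (forall i, (r i < k i)%nat) /\ (forall i, Rabs (th i) <= 2 * PI) /\
      (forall i, Rabs (v i) <= q) /\ Rabs t <= / (INR m + 1) /\
      eps < Cmod (F (phi_r phi r (expI (fun i => th i + t * v i))) - F (phi_r phi r (expI th))))
    by (intros m; apply (proj2_sig (constructive_indefinite_description _ (Hseq m)))).
  clearbody d.
  assert (Hd' : forall m, let r := fst (fst (fst (d m))) in let th := snd (fst (fst (d m))) in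
    let v := snd (fst (d m)) in let t := snd (d m) in
    (forall i, (r i < k i)%nat) /\ (forall i, Rabs (th i) <= 2 * PI) /\
      (forall i, Rabs (v i) <= q) /\ Rabs t <= / (INR m + 1) /\
      eps < Cmod (F (phi_r phi r (expI (fun i => th i + t * v i))) - F (phi_r phi r (expI th)))).
  { intros m. specialize (Hd m). destruct (d m) as [[[r th] v] t]. exact Hd. }
  clear Hd. set (r := fun m => fst (fst (fst (d m)))) in *.
  set (th := fun m => snd (fst (fst (d m)))) in *. set (v := fun m => snd (fst (d m))) in *.
  set (t := fun m => snd (d m)) in *.
  change (forall m, (forall i, (r m i < k i)%nat) /\ (forall i, Rabs (th m i) <= 2 * PI) /\
      (forall i, Rabs (v m i) <= q) /\ Rabs (t m) <= / (INR m + 1) /\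
      eps < Cmod (F (phi_r phi (r m) (expI (fun i => th m i + t m * v m i)))
        - F (phi_r phi (r m) (expI (th m))))) in Hd'.
  clearbody r th v t.
  destruct (torus_data_cluster e k r th v (2 * PI) q He) as [r0 [th0 [v0 [Hr0 Hcl]]]];
    try (intros m; apply Hd').
  destruct (phi_r_continuous e Om k V phi F r0 (expI th0) (eps / 2) He HH HF Hr0
    (expI_in_torus th0) ltac:(lra)) as [N [del [Hdel Hc]]].
  assert (Hdq : 0 < del / (8 * q)) by (apply Rdiv_lt_0_compat; lra).
  destruct (archimed_cor1 (del / (8 * q)) Hdq) as [M [HM HM0]].
  destruct (Hcl N M (del / 8) ltac:(lra)) as [m [Hm Hn]].
  destruct (Hd' m) as [D1 [D2 [D3 [D4 D5]]]].
  assert (Htq : Rabs (t m) * q < del / 8).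
  { apply Rle_lt_trans with (/ INR M * q).
    - apply Rmult_le_compat_r; [lra|]. eapply Rle_trans; [exact D4|].
      apply Rinv_le_contravar; [apply lt_0_INR; lia|]. apply le_INR in Hm. lra.
    - replace (del / 8) with (del / (8 * q) * q) by (field; lra).
      apply Rmult_lt_compat_r; lra. }
  assert (K1 := Hc (r m) (expI (th m)) D1 (expI_in_torus _)).
  assert (K2 := Hc (r m) (expI (fun i => th m i + t m * v m i)) D1 (expI_in_torus _)).
  assert (K1' := K1 ltac:(intros n Hn'; destruct (Hn n Hn') as [E1 [E2 _]]; split; [exact E1|];
    unfold expI; eapply Rle_lt_trans; [apply cexpi_lipschitz|lra])).
  assert (K2' : Cmod (F (phi_r phi (r m) (expI (fun i => th m i + t m * v m i)))
     - F (phi_r phi r0 (expI th0))) < eps / 2).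
  { apply K2. intros n Hn'. destruct (Hn n Hn') as [E1 [E2 _]]. split; [exact E1|].
    unfold expI. eapply Rle_lt_trans; [apply cexpi_lipschitz|].
    assert (T := Rabs_triang (th m (e n) - th0 (e n)) (t m * v m (e n))).
    rewrite Rabs_mult in T.
    replace (th m (e n) + t m * v m (e n) - th0 (e n))
      with (th m (e n) - th0 (e n) + t m * v m (e n)) by ring.
    assert (Rabs (t m) * Rabs (v m (e n)) <= Rabs (t m) * q)
      by (apply Rmult_le_compat_l; [apply Rabs_pos|apply D3]).
    lra. }
  set (a := F (phi_r phi (r m) (expI (fun i => th m i + t m * v m i)))) in *.
  assert (T := Cmod_minus_triangle a (F (phi_r phi r0 (expI th0))) (F (phi_r phi (r m) (expI (th m))))).
  rewrite (Cmod_minus_sym (F (phi_r phi r0 _))) in T. lra.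
Qed.

(** * Generic steepness *)

(* Over all [q], with [eta = 0], this is equivalent to all the conditions [D_nks]: the norm of [v]
   lies between [/ q] and [q], so it can be absorbed in the slope. Unlike
   the sup norm, which is only lower semicontinuous on the product, the slope [q] allows a
   compactness argument. *)
Definition steep {I : Type} (k : I -> nat) (phi : I -> nat -> C -> Chat)
  (q : nat) (i0 : I) (j : nat) (eta : R) (f : (I -> C) -> C) : Prop :=
  forall r, (forall i, (r i < k i)%nat) -> r i0 = j -> forall th v : I -> R,
    (forall i, Rabs (v i) <= INR q) -> / INR q <= Rabs (v i0) ->
    exists t, Rabs t < / INR q /\
      INR q * Rabs t + eta < Rabs (Re (f (phi_r phi r (expI th)))
        - Re (f (phi_r phi r (expI (fun i => th i + t * v i))))).

Lemma Re_minus_le (a b : C) : Rabs (Re a - Re b) <= Cmod (a - b).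
Proof. apply (re_le_Cmod (a - b)%C). Qed.

(** The same [t] works; each of the two values moves by at most [del], so the margin drops by
    [2 * del]. This yields both openness and the control of the tail of the series. *)
Lemma steep_perturb {I : Type} (Om : I -> C -> Prop) k V phi q i0 j eta eta' del f g :
  holes Om k V phi -> (forall x, in_clOm Om x -> Cmod (f x - g x) <= del) ->
  eta' + 2 * del <= eta -> steep k phi q i0 j eta f -> steep k phi q i0 j eta' g.
Proof.
  intros HH Hfg Hle Hf r Hr Hj th v Hv Hv0.
  destruct (Hf r Hr Hj th v Hv Hv0) as [t [Ht Hlt]]. exists t. split; [exact Ht|].
  set (x := phi_r phi r (expI th)) in *.
  set (y := phi_r phi r (expI (fun i => th i + t * v i))) in *.
  assert (Hx : in_clOm Om x) by (apply (phi_r_in_clOm Om k V); auto; apply expI_in_torus).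
  assert (Hy : in_clOm Om y) by (apply (phi_r_in_clOm Om k V); auto; apply expI_in_torus).
  assert (H1 := Rle_trans _ _ _ (Re_minus_le _ _) (Hfg x Hx)).
  assert (H2 := Rle_trans _ _ _ (Re_minus_le _ _) (Hfg y Hy)).
  assert (T := Rabs_triang (Re (f x) - Re (g x)) (Re (g x) - Re (g y) + (Re (g y) - Re (f y)))).
  assert (T' := Rabs_triang (Re (g x) - Re (g y)) (Re (g y) - Re (f y))).
  rewrite (Rabs_minus_sym (Re (g y)) (Re (f y))) in T'.
  replace (Re (f x) - Re (g x) + (Re (g x) - Re (g y) + (Re (g y) - Re (f y))))
    with (Re (f x) - Re (f y)) in T by ring.
  lra.
Qed.

(** Data failing with margin [1 / (m + 1)] cluster at some [(r0, th0, v0)], which is still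
    admissible because the constraints on [r i0] and [v] are closed. The strict inequality at the
    limit holds for one [t], and that same [t] serves the nearby data. *)
Lemma steep_compact {I : Type} (e : nat -> I) (Om : I -> C -> Prop) k V phi q i0 j f :
  (forall i, exists m, e m = i) -> holes Om k V phi -> cont_on_cl Om f -> (1 <= q)%nat ->
  steep k phi q i0 j 0 f -> exists eta, 0 < eta /\ steep k phi q i0 j eta f.
Proof.
  intros He HH Hf Hq Hst. apply NNPP. intros Hno.
  assert (Hq1 : 1 <= INR q) by (apply (le_INR 1); exact Hq).
  set (D := fun (d : (I -> nat) * (I -> R) * (I -> R)) (t : R) =>
    Rabs (Re (f (phi_r phi (fst (fst d)) (expI (snd (fst d)))))
        - Re (f (phi_r phi (fst (fst d)) (expI (fun i => snd (fst d) i + t * snd d i)))))).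
  assert (Hseq : forall m : nat, exists d : (I -> nat) * (I -> R) * (I -> R),
    (forall i, (fst (fst d) i < k i)%nat) /\ fst (fst d) i0 = j /\
    (forall i, Rabs (snd (fst d) i) <= 2 * PI) /\
    (forall i, Rabs (snd d i) <= INR q) /\ / INR q <= Rabs (snd d i0) /\
    forall t, Rabs t < / INR q -> D d t <= INR q * Rabs t + / (INR m + 1)).
  { intros m. apply NNPP. intros H. apply Hno. exists (/ (INR m + 1)).
    split; [apply Rinv_0_lt_compat; generalize (pos_INR m); lra|].
    intros r Hr Hj th v Hv Hv0. apply NNPP. intros Ht. apply H.
    destruct (angle_reduction th) as [th' [Hb E]].
    exists (r, th', v). cbn [fst snd]. do 5 (split; [assumption|]).
    intros t Htq. apply Rnot_lt_le. intros Hlt. apply Ht. exists t. split; [exact Htq|].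
    unfold D in Hlt. cbn [fst snd] in Hlt.
    rewrite (E (fun i => t * v i)), <- (expI_shift0 th'), (E (fun _ => 0)), expI_shift0 in Hlt.
    exact Hlt. }
  set (d := fun m => proj1_sig (constructive_indefinite_description _ (Hseq m))).
  assert (Hd := fun m => proj2_sig (constructive_indefinite_description _ (Hseq m))).
  fold d in Hd. change (forall m,
    (forall i, (fst (fst (d m)) i < k i)%nat) /\ fst (fst (d m)) i0 = j /\
    (forall i, Rabs (snd (fst (d m)) i) <= 2 * PI) /\
    (forall i, Rabs (snd (d m) i) <= INR q) /\ / INR q <= Rabs (snd (d m) i0) /\
    forall t, Rabs t < / INR q -> D (d m) t <= INR q * Rabs t + / (INR m + 1)) in Hd.
  clearbody d.
  destruct (torus_data_cluster e k (fun m => fst (fst (d m))) (fun m => snd (fst (d m)))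
    (fun m => snd (d m)) (2 * PI) (INR q) He) as [r0 [th0 [v0 [Hr0 Hcl]]]];
    try (intros m; apply Hd).
  assert (Hj0 : r0 i0 = j).
  { destruct (He i0) as [n0 En0].
    destruct (Hcl (S n0) 0%nat 1 ltac:(lra)) as [m [_ Hn]].
    destruct (Hn n0 ltac:(lia)) as [E _]. rewrite En0 in E. rewrite <- E. apply Hd. }
  assert (Hv : forall i, Rabs (v0 i) <= INR q).
  { intros i. apply (le_of_le_plus_eps_mult _ _ 1). intros eps Heps. destruct (He i) as [n0 En0].
    destruct (Hcl (S n0) 0%nat eps Heps) as [m [_ Hn]].
    destruct (Hn n0 ltac:(lia)) as [_ [_ E]]. rewrite En0 in E.
    destruct (Hd m) as [_ [_ [_ [K _]]]]. specialize (K i).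
    assert (T := Rabs_triang_inv (v0 i) (snd (d m) i)). rewrite Rabs_minus_sym in T. lra. }
  assert (Hv0 : / INR q <= Rabs (v0 i0)).
  { apply (le_of_le_plus_eps_mult _ _ 1). intros eps Heps. destruct (He i0) as [n0 En0].
    destruct (Hcl (S n0) 0%nat eps Heps) as [m [_ Hn]].
    destruct (Hn n0 ltac:(lia)) as [_ [_ E]]. rewrite En0 in E.
    destruct (Hd m) as [_ [_ [_ [_ [K _]]]]].
    assert (T := Rabs_triang_inv (snd (d m) i0) (v0 i0)). lra. }
  destruct (Hst r0 Hr0 Hj0 th0 v0 Hv Hv0) as [t [Ht Hlt]].
  set (x0 := expI th0) in *. set (y0 := expI (fun i => th0 i + t * v0 i)) in *.
  (* Budget: [gap / 4] at each of the two points and [gap / 2] for the margin [1 / (m + 1)]. *)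
  set (gap := Rabs (Re (f (phi_r phi r0 x0)) - Re (f (phi_r phi r0 y0))) - INR q * Rabs t).
  assert (Hgap : 0 < gap) by (unfold gap; lra).
  destruct (phi_r_continuous e Om k V phi f r0 x0 (gap / 4) He HH Hf Hr0
    (expI_in_torus _) ltac:(lra)) as [N1 [d1 [Hd1 C1]]].
  destruct (phi_r_continuous e Om k V phi f r0 y0 (gap / 4) He HH Hf Hr0
    (expI_in_torus _) ltac:(lra)) as [N2 [d2 [Hd2 C2]]].
  destruct (archimed_cor1 (gap / 2) ltac:(lra)) as [M [HM HM0]].
  set (dd := Rmin d1 d2).
  assert (Hdd : 0 < dd) by (apply Rmin_glb_lt; assumption).
  assert (Hdd1 : dd <= d1) by apply Rmin_l. assert (Hdd2 : dd <= d2) by apply Rmin_r.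
  destruct (Hcl (Nat.max N1 N2) M (dd / 8) ltac:(lra)) as [m [Hm Hn]].
  destruct (Hd m) as [A1 [_ [_ [_ [_ A6]]]]].
  assert (K := A6 t Ht). unfold D in K.
  assert (Ht1 : Rabs t <= 1).
  { apply Rlt_le. eapply Rlt_le_trans; [exact Ht|]. rewrite <- Rinv_1.
    apply Rinv_le_contravar; lra. }
  assert (B1 : Cmod (f (phi_r phi (fst (fst (d m))) (expI (snd (fst (d m)))))
      - f (phi_r phi r0 x0)) < gap / 4).
  { apply C1; [exact A1|apply expI_in_torus|]. intros n Hn'.
    destruct (Hn n ltac:(lia)) as [E1 [E2 _]]. split; [exact E1|]. unfold x0, expI.
    eapply Rle_lt_trans; [apply cexpi_lipschitz|lra]. }
  assert (B2 : Cmod (f (phi_r phi (fst (fst (d m))) (expI (fun i => snd (fst (d m)) i + t * snd (d m) i)))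
      - f (phi_r phi r0 y0)) < gap / 4).
  { apply C2; [exact A1|apply expI_in_torus|]. intros n Hn'.
    destruct (Hn n ltac:(lia)) as [E1 [E2 E3]]. split; [exact E1|]. unfold y0, expI.
    eapply Rle_lt_trans; [apply cexpi_lipschitz|].
    replace (snd (fst (d m)) (e n) + t * snd (d m) (e n) - (th0 (e n) + t * v0 (e n)))
      with ((snd (fst (d m)) (e n) - th0 (e n)) + t * (snd (d m) (e n) - v0 (e n))) by ring.
    assert (T := Rabs_triang (snd (fst (d m)) (e n) - th0 (e n)) (t * (snd (d m) (e n) - v0 (e n)))).
    rewrite Rabs_mult in T. assert (P1 := Rabs_pos t).
    assert (P2 := Rabs_pos (snd (d m) (e n) - v0 (e n))). nra. }
  assert (HMm : / (INR m + 1) < gap / 2).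
  { eapply Rle_lt_trans; [|exact HM]. apply Rinv_le_contravar; [apply lt_0_INR; lia|].
    apply le_INR in Hm. lra. }
  apply (Rle_lt_trans _ _ _ (Re_minus_le _ _)) in B1.
  apply (Rle_lt_trans _ _ _ (Re_minus_le _ _)) in B2.
  set (X := Re (f (phi_r phi (fst (fst (d m))) (expI (snd (fst (d m))))))) in *.
  set (Y := Re (f (phi_r phi (fst (fst (d m))) (expI (fun i => snd (fst (d m)) i + t * snd (d m) i))))) in *.
  set (X0 := Re (f (phi_r phi r0 x0))) in *. set (Y0 := Re (f (phi_r phi r0 y0))) in *.
  assert (T1 := Rabs_triang (X0 - X) ((X - Y) + (Y - Y0))).
  assert (T2 := Rabs_triang (X - Y) (Y - Y0)).
  replace (X0 - X + (X - Y + (Y - Y0))) with (X0 - Y0) in T1 by ring.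
  rewrite (Rabs_minus_sym X0 X) in T1. unfold gap in *. lra.
Qed.

(** Forwards take [s = q] and [n = q * q]: since [|v i0| >= 1 / q], the norm [M] of [t * v] is at
    least [|t| / q], so [n * M >= q * |t|]. Backwards take [q = n * s]: since [M <= s * |t|], one
    has [n * M <= q * |t|]. *)
Lemma S_I_iff_steep {I : Type} (e : nat -> I) (Om : I -> C -> Prop) k V phi f :
  (forall i, exists m, e m = i) -> holes Om k V phi ->
  (S_I Om k phi f <-> inA Om f /\ forall q i0 j, (1 <= q)%nat -> (j < k i0)%nat ->
     steep k phi q i0 j 0 f).
Proof.
  intros He HH. split.
  - intros [HA HS]. split; [exact HA|]. intros q i0 j Hq _ r Hr _ th v Hv Hv0.
    assert (Hq1 : 1 <= INR q) by (apply (le_INR 1); exact Hq).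
    destruct (HS i0 q (q * q)%nat Hq ltac:(nia)) as [_ HE].
    destruct (HE r Hr) as [_ HD].
    destruct (HD th v (conj Hv0 (Hv i0)) Hv) as [t [Ht [M [[HM _] Hlt]]]].
    rewrite mult_INR in *. exists t.
    assert (Hqq : / (INR q * INR q) <= / INR q) by (apply Rinv_le_contravar; nra).
    split; [apply Rabs_def1; lra|].
    assert (HMt : Rabs t * / INR q <= M).
    { apply Rle_trans with (Rabs (t * v i0)).
      - rewrite Rabs_mult. apply Rmult_le_compat_l; [apply Rabs_pos|exact Hv0].
      - apply HM. exists i0. f_equal. ring. }
    assert (HMq : Rabs t <= INR q * M).
    { apply Rmult_le_compat_l with (r := INR q) in HMt; [|lra].
      replace (INR q * (Rabs t * / INR q)) with (Rabs t) in HMt by (field; lra). exact HMt. }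
    cbv beta zeta in Hlt. nra.
  - intros [HA HS]. split; [exact HA|]. intros i0 s n Hs Hn. split; [exact HA|].
    intros r Hr. split.
    + intros z Hz eps Heps.
      destruct (phi_r_continuous e Om k V phi f r z eps He HH (proj1 HA) Hr Hz Heps)
        as [N [del [Hdel Hc]]].
      exists (List.map e (List.seq 0 N)), del. split; [exact Hdel|]. intros y Hy Hi.
      eapply Rle_lt_trans; [apply Re_minus_le|]. apply Hc; [exact Hr|exact Hy|].
      intros m Hm. split; [reflexivity|]. apply (Hi (e m)). apply List.in_map, List.in_seq. lia.
    + intros th v Hv0 Hv.
      assert (Hn1 : 1 <= INR n) by (apply (le_INR 1); exact Hn).
      assert (Hs1 : 1 <= INR s) by (apply (le_INR 1); exact Hs).
      destruct (HS (n * s)%nat i0 (r i0) ltac:(nia) (Hr i0) r Hr eq_refl th v) as [t [Ht Hlt]].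
      { intros i. rewrite mult_INR. specialize (Hv i). nra. }
      { rewrite mult_INR. eapply Rle_trans; [|apply Hv0]. apply Rinv_le_contravar; nra. }
      rewrite mult_INR in *.
      assert (Hns : / (INR n * INR s) <= / INR n) by (apply Rinv_le_contravar; nra).
      exists t. apply Rabs_def2 in Ht as Ht'. split; [lra|]. cbv zeta.
      assert (Hb : forall j, Rabs (th j + t * v j - th j) <= Rabs t * INR s).
      { intros j. replace (th j + t * v j - th j) with (t * v j) by ring. rewrite Rabs_mult.
        apply Rmult_le_compat_l; [apply Rabs_pos|apply Hv]. }
      destruct (completeness (fun x => exists j, x = Rabs (th j + t * v j - th j))) as [M HM].
      { exists (Rabs t * INR s). intros x [j ->]. apply Hb. }
      { exists (Rabs (th i0 + t * v i0 - th i0)), i0. reflexivity. }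
      exists M. split; [exact HM|].
      assert (HMs : M <= Rabs t * INR s) by (apply HM; intros x [j ->]; apply Hb).
      apply Rle_lt_trans with (INR n * INR s * Rabs t + 0); [nra|exact Hlt].
Qed.

(** * The G-delta property *)

(** Enumerates the triples [(q, i0, j)] with [q] positive. Values [j >= k i0] occur as well, whence
    the guards [j < k i0] in its uses. *)
Definition decode {I : Type} (e : nat -> I) (m : nat) : nat * I * nat :=
  let (a, b) := Cantor.of_nat m in let (c, j) := Cantor.of_nat b in (S a, e c, j).

Lemma decode_surj {I : Type} (e : nat -> I) q i j : (forall i, exists m, e m = i) ->
  (1 <= q)%nat -> exists m, decode e m = (q, i, j).
Proof.
  intros He Hq. destruct (He i) as [c Hc].
  exists (Cantor.to_nat (pred q, Cantor.to_nat (c, j))). unfold decode.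
  rewrite !Cantor.cancel_of_to, Hc. replace (S (pred q)) with q by lia. reflexivity.
Qed.

Lemma decode_pos {I : Type} (e : nat -> I) m : (1 <= fst (fst (decode e m)))%nat.
Proof.
  unfold decode. destruct (Cantor.of_nat m) as [a b]. destruct (Cantor.of_nat b). simpl. lia.
Qed.

Lemma S_I_Gdelta {I : Type} (e : nat -> I) (Om : I -> C -> Prop) k V phi :
  (forall i, exists m, e m = i) -> holes Om k V phi -> GdeltaA Om (S_I Om k phi).
Proof.
  intros He HH.
  (* Requiring some positive margin makes the condition open; by [steep_compact] it is no stronger
     than margin 0. *)
  exists (fun m f => let '(q, i0, j) := decode e m in (j < k i0)%nat ->
    exists eta, 0 < eta /\ steep k phi q i0 j eta f).
  split.
  - intros m f HA. destruct (decode e m) as [[q i0] j]. intros HU.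
    destruct (Nat.lt_ge_cases j (k i0)) as [Hj|Hj].
    (* A ball of radius [eta / 4] costs at most [eta / 2], so half of the margin remains. *)
    + destruct (HU Hj) as [eta [Heta Hst]]. exists (eta / 4). split; [lra|].
      intros g _ [del [Hdel Hd]] _. exists (eta / 2). split; [lra|].
      apply (steep_perturb Om k V phi q i0 j eta (eta / 2) del f g); auto. lra.
    + exists 1. split; [lra|]. intros g _ _ Hj'. lia.
  - intros f. rewrite (S_I_iff_steep e Om k V phi f He HH). split.
    + intros [HA HS]. split; [exact HA|]. intros m. assert (Hp := decode_pos e m).
      destruct (decode e m) as [[q i0] j]. intros Hj.
      apply (steep_compact e Om k V phi q i0 j f); auto. exact (proj1 HA).
    + intros [HA HU]. split; [exact HA|]. intros q i0 j Hq Hj.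
      destruct (decode_surj e q i0 j He Hq) as [m Em]. specialize (HU m). rewrite Em in HU.
      destruct (HU Hj) as [eta [Heta Hst]].
      apply (steep_perturb Om k V phi q i0 j eta 0 0 f f); auto; [|lra].
      intros x _. replace (f x - f x)%C with (RtoC 0) by ring. rewrite Cmod_0. lra.
Qed.

(** * Density *)

Definition admissible (O : C -> Prop) (H : C -> C) : Prop :=
  quad_diff O 1 H /\ cont_cl O H /\ forall x, d_closure cdist O x -> Cmod (H x) <= 2.

(* At the scale where [H] oscillates, [F] is almost constant by uniform continuity. *)
Lemma oscillation_step {I : Type} (e : nat -> I) (Om : I -> C -> Prop) k V phi F (a : R) q i0 j :
  (forall i, exists m, e m = i) -> holes Om k V phi -> cont_on_cl Om F -> 0 < a -> (1 <= q)%nat ->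
  exists H, admissible (Om i0) H /\ ((j < k i0)%nat ->
    steep k phi q i0 j (a / 8) (fun x => F x + a * H (x i0))%C).
Proof.
  intros He HH HF Ha Hq. assert (Hq1 : 1 <= INR q) by (apply (le_INR 1); exact Hq).
  destruct (Nat.lt_ge_cases j (k i0)) as [Hj|Hj].
  2:{ exists (fun _ => RtoC 0). split; [|lia]. split; [|split].
      - apply quad_diff_weaken with 0; [lra|apply quad_diff_const].
      - apply cont_cl_const.
      - intros x _. rewrite Cmod_0. lra. }
  destruct (uniform_continuity_torus e Om k V phi F (INR q) (a / 16) He HH HF
    ltac:(lra) ltac:(lra)) as [tau [Htau Hu]].
  (* For [|t| <= s]: [tau] keeps the change of [F] below [a / 16], [/ (2 * INR q)] gives
     [|t| < / INR q], and the last term gives [q * |t| <= a / 16]. A gain of [3/8 * a] from [H] then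
     leaves more than [a / 8]. *)
  set (s := Rmin tau (Rmin (/ (2 * INR q)) (a / (16 * INR q)))).
  assert (Hi : 0 < / (2 * INR q)) by (apply Rinv_0_lt_compat; lra).
  assert (Ha' : 0 < a / (16 * INR q)) by (apply Rdiv_lt_0_compat; lra).
  assert (Hs : 0 < s /\ s <= tau /\ s <= / (2 * INR q) /\ s <= a / (16 * INR q)).
  { assert (A1 := Rmin_l tau (Rmin (/ (2 * INR q)) (a / (16 * INR q)))).
    assert (A2 := Rmin_r tau (Rmin (/ (2 * INR q)) (a / (16 * INR q)))).
    assert (A3 := Rmin_l (/ (2 * INR q)) (a / (16 * INR q))).
    assert (A4 := Rmin_r (/ (2 * INR q)) (a / (16 * INR q))).
    fold s in A1, A2. repeat split; try lra. unfold s. repeat apply Rmin_glb_lt; lra. }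
  clearbody s. destruct Hs as [Hs0 [Hs1 [Hs2 Hs3]]].
  (* An angular shift [b = t * v i0] requires [t = b / v i0], and [|v i0| >= 1 / q]; shifts up to
     [s / q] thus cost [|t| <= s]. *)
  destruct (oscillating_function (Om i0) (V i0 j) (phi i0 j) (s / INR q) (HH i0 j Hj))
    as [H [Q [HC [H2 Hosc]]]]; [apply Rdiv_lt_0_compat; lra|].
  exists H. split; [split; [exact Q|split; [exact HC|exact H2]]|]. intros _.
  intros r Hr Hrj th v Hv Hv0.
  assert (Hiq : 0 < / INR q) by (apply Rinv_0_lt_compat; lra).
  assert (Hvn : v i0 <> 0) by (intros E; rewrite E, Rabs_R0 in Hv0; lra).
  set (h := fun t => Re (H (bcurve (phi i0 j) (th i0 + t * v i0)))).
  (* Two values differing by [3 / 4] cannot both be within less than [3 / 8] of the value at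
     [t = 0]. *)
  assert (Hgain : exists t, Rabs t <= s /\ 3 / 8 <= Rabs (h 0 - h t)).
  { destruct (Hosc (th i0)) as [b1 [b2 [Hb1 [Hb2 Hb]]]].
    assert (Hscale : forall b, Rabs b <= s / INR q -> Rabs (b / v i0) <= s).
    { intros b Hb'. unfold Rdiv. rewrite Rabs_mult, Rabs_inv.
      apply Rle_trans with (s / INR q * INR q); [|right; field; lra].
      apply Rmult_le_compat; [apply Rabs_pos| |exact Hb'|].
      - left. apply Rinv_0_lt_compat. lra.
      - rewrite <- (Rinv_inv (INR q)). apply Rinv_le_contravar; assumption. }
    assert (E1 : Re (H (bcurve (phi i0 j) (th i0 + b1))) = h (b1 / v i0)).
    { unfold h. do 3 f_equal. field. exact Hvn. }
    assert (E2 : Re (H (bcurve (phi i0 j) (th i0 + b2))) = h (b2 / v i0)).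
    { unfold h. do 3 f_equal. field. exact Hvn. }
    rewrite E1, E2 in Hb.
    destruct (Rle_lt_dec (3 / 8) (Rabs (h 0 - h (b1 / v i0)))) as [L|L].
    - exists (b1 / v i0). auto.
    - exists (b2 / v i0). split; [auto|]. apply Rabs_def2 in L.
      eapply Rle_trans; [|apply Rle_abs]. lra. }
  destruct Hgain as [t [Ht Hgain]]. exists t. split.
  { eapply Rle_lt_trans; [exact Ht|]. eapply Rle_lt_trans; [exact Hs2|].
    apply Rinv_lt_contravar; nra. }
  assert (K := Rle_trans _ _ _ (Re_minus_le _ _) (Hu r th v t Hr Hv ltac:(lra))).
  assert (HqT : INR q * Rabs t <= a / 16).
  { apply Rle_trans with (INR q * (a / (16 * INR q))); [|right; field; lra].
    apply Rmult_le_compat_l; lra. }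
  set (x := phi_r phi r (expI th)) in *.
  set (y := phi_r phi r (expI (fun i => th i + t * v i))) in *.
  assert (Ex : Re (F x + a * H (x i0))%C = Re (F x) + a * h 0).
  { unfold h. replace (th i0 + 0 * v i0) with (th i0) by ring. rewrite <- Hrj.
    change (bcurve (phi i0 (r i0)) (th i0)) with (x i0).
    unfold Re; simpl. ring. }
  assert (Ey : Re (F y + a * H (y i0))%C = Re (F y) + a * h t).
  { unfold h. rewrite <- Hrj.
    change (bcurve (phi i0 (r i0)) (th i0 + t * v i0)) with (y i0).
    unfold Re; simpl. ring. }
  rewrite Ex, Ey.
  assert (T := Rabs_triang (Re (F x) + a * h 0 - (Re (F y) + a * h t)) (Re (F y) - Re (F x))).
  replace (Re (F x) + a * h 0 - (Re (F y) + a * h t) + (Re (F y) - Re (F x)))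
    with (a * (h 0 - h t)) in T by ring.
  rewrite Rabs_mult, (Rabs_pos_eq a) in T by lra. nra.
Qed.

Lemma cont_on_cl_step {I : Type} (Om : I -> C -> Prop) F (a : R) H i0 : 0 < a ->
  cont_on_cl Om F -> cont_cl (Om i0) H -> cont_on_cl Om (fun x => F x + a * H (x i0))%C.
Proof.
  intros Ha HF HH x Hx eps Heps.
  destruct (HF x Hx (eps / 2) ltac:(lra)) as [Fl [d1 [Hd1 H1]]].
  destruct (HH (x i0) (Hx i0) (eps / (2 * a))) as [d2 [Hd2 H2]]; [apply Rdiv_lt_0_compat; lra|].
  exists (cons i0 Fl), (Rmin d1 d2). split; [apply Rmin_glb_lt; assumption|].
  intros y Hy Hi. unfold cdist in *.
  replace (F y + a * H (y i0) - (F x + a * H (x i0)))%C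
    with ((F y - F x) + a * (H (y i0) - H (x i0)))%C by ring.
  eapply Rle_lt_trans; [apply Cmod_triangle|]. rewrite Cmod_mult, Cmod_R, Rabs_pos_eq by lra.
  assert (K1 : Cmod (F y - F x) < eps / 2).
  { apply H1; [exact Hy|]. intros i Hin. eapply Rlt_le_trans; [apply Hi; right; exact Hin|apply Rmin_l]. }
  assert (K2 : Cmod (H (y i0) - H (x i0)) < eps / (2 * a)).
  { apply H2; [apply Hy|]. eapply Rlt_le_trans; [apply Hi; left; reflexivity|apply Rmin_r]. }
  apply Rlt_div_r in K2; lra.
Qed.

Lemma in_Om_in_clOm {I : Type} (Om : I -> C -> Prop) x : in_Om Om x -> in_clOm Om x.
Proof.
  intros H i eps Heps. exists (x i). split; [apply H|]. unfold cdist.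
  replace (x i - x i)%C with (RtoC 0) by ring. rewrite Cmod_0. exact Heps.
Qed.

Lemma in_Om_upd {I : Type} (Om : I -> C -> Prop) x i0 w : in_Om Om x -> Om i0 w -> in_Om Om (upd x i0 w).
Proof.
  intros H Hw i. unfold upd. destruct (ClassicalDescription.excluded_middle_informative (i = i0)) as [->|]; auto.
Qed.

Lemma quad_diff_ext O kap H1 H2 : (forall w, H1 w = H2 w) -> quad_diff O kap H1 -> quad_diff O kap H2.
Proof. intros E. replace H2 with H1; [auto|]. apply functional_extensionality, E. Qed.

Lemma pow100_pos (m : nat) : 0 < (/ 100) ^ m.
Proof. apply pow_lt. lra. Qed.

(** The [m]-th term treats the triple [decode e m], and its [H] depends on the partial sum already
    built, whose modulus of continuity fixes the scale of oscillation. *)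
Lemma S_I_dense {I : Type} (e : nat -> I) (Om : I -> C -> Prop) k V phi :
  (forall i, exists m, e m = i) -> holes Om k V phi -> (forall i, d_open cdist (Om i)) ->
  denseA Om (S_I Om k phi).
Proof.
  intros He HH Hop. split; [intros f [HA _]; exact HA|].
  intros f HA eps Heps.
  set (a := fun m => eps / 100 * (/ 100) ^ m).
  assert (Ha : forall m, 0 < a m) by (intros m; apply Rmult_lt_0_compat; [lra|apply pow100_pos]).
  set (ix := fun m => snd (fst (decode e m))).
  (* The choice is made total, with a dummy function for discontinuous [F], so that the recursion
     [T] can be defined before its continuity is proved. *)
  assert (Hch : forall m F, exists H, cont_on_cl Om F -> admissible (Om (ix m)) H /\
    ((snd (decode e m) < k (ix m))%nat ->
      steep k phi (fst (fst (decode e m))) (ix m) (snd (decode e m)) (a m / 8)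
        (fun x => F x + a m * H (x (ix m)))%C)).
  { intros m F. destruct (classic (cont_on_cl Om F)) as [HF|HF].
    - destruct (oscillation_step e Om k V phi F (a m) (fst (fst (decode e m))) (ix m)
        (snd (decode e m)) He HH HF (Ha m) (decode_pos e m)) as [H HH'].
      exists H. intros _. exact HH'.
    - exists (fun _ => RtoC 0). intros; contradiction. }
  set (Hs := fun m F => proj1_sig (constructive_indefinite_description _ (Hch m F))).
  assert (HHs := fun m F => proj2_sig (constructive_indefinite_description _ (Hch m F))).
  change (forall m F, cont_on_cl Om F -> admissible (Om (ix m)) (Hs m F) /\
    ((snd (decode e m) < k (ix m))%nat ->
      steep k phi (fst (fst (decode e m))) (ix m) (snd (decode e m)) (a m / 8)
        (fun x => F x + a m * Hs m F (x (ix m)))%C)) in HHs.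
  clearbody Hs. clear Hch.
  set (T := fix T m : (I -> C) -> C := match m with O => f
    | S m => fun x => (T m x + a m * Hs m (T m) (x (ix m)))%C end).
  assert (TS : forall m x, T (S m) x = (T m x + a m * Hs m (T m) (x (ix m)))%C) by reflexivity.
  assert (HT : forall m, cont_on_cl Om (T m)).
  { induction m as [|m IH]; [exact (proj1 HA)|]. apply cont_on_cl_step; auto. apply (HHs m (T m) IH). }
  assert (Hstep : forall x, in_clOm Om x -> forall m, Cmod (T (S m) x - T m x) <= eps / 50 * (/ 100) ^ m).
  { intros x Hx m. rewrite TS. replace (T m x + a m * Hs m (T m) (x (ix m)) - T m x)%C
      with (a m * Hs m (T m) (x (ix m)))%C by ring.
    rewrite Cmod_mult, Cmod_R, Rabs_pos_eq by (left; apply Ha).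
    destruct (HHs m (T m) (HT m)) as [[_ [_ Hb]] _]. specialize (Hb (x (ix m)) (Hx (ix m))).
    replace (eps / 50 * (/ 100) ^ m) with (a m * 2) by (unfold a; field).
    apply Rmult_le_compat_l; [left; apply Ha|exact Hb]. }
  (* The limit is chosen pointwise; off the closure, where convergence is not asserted, the value is
     arbitrary. *)
  set (g := fun x => epsilon (inhabits (RtoC 0))
    (fun y => forall m, Cmod (T m x - y) <= 200 / 99 * (eps / 50) * (/ 100) ^ m)).
  assert (Hg : forall x, in_clOm Om x -> forall m,
    Cmod (T m x - g x) <= 200 / 99 * (eps / 50) * (/ 100) ^ m).
  { intros x Hx. apply (epsilon_spec (inhabits (RtoC 0))
    (fun y => forall m, Cmod (T m x - y) <= 200 / 99 * (eps / 50) * (/ 100) ^ m)).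
    apply C_geometric_limit. apply Hstep, Hx. }
  clearbody g.
  assert (Hsmall : forall del, 0 < del -> exists N, forall m, (N <= m)%nat ->
    200 / 99 * (eps / 50) * (/ 100) ^ m < del).
  { intros del Hdel.
    destruct (pow_lt_1_zero (/ 100) ltac:(rewrite Rabs_pos_eq; lra) (del / (200 / 99 * (eps / 50))))
      as [N HN]; [apply Rdiv_lt_0_compat; lra|].
    exists N. intros m Hm. specialize (HN m Hm).
    rewrite Rabs_pos_eq in HN by (left; apply pow100_pos). apply Rlt_div_r in HN; lra. }
  assert (HgA : inA Om g).
  { split.
    - intros x Hx del Hdel. destruct (Hsmall (del / 4) ltac:(lra)) as [N HN].
      specialize (HN N (le_n N)).
      destruct (HT N x Hx (del / 4) ltac:(lra)) as [Fl [d [Hd Hc]]].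
      exists Fl, d. split; [exact Hd|]. intros y Hy Hi.
      assert (K := Hc y Hy Hi). unfold cdist in *.
      assert (K1 := Hg x Hx N). assert (K2 := Hg y Hy N).
      assert (T1 := Cmod_minus_triangle (g y) (T N y) (g x)).
      assert (T2 := Cmod_minus_triangle (T N y) (T N x) (g x)).
      rewrite (Cmod_minus_sym (g y) (T N y)) in T1. lra.
    - intros x Hx i0.
      (* Differences with [f] are estimated, since [f] is only known to be holomorphic and carries
         no quadratic bound; it is added back at the end. The factor [1 - (/ 100) ^ m] absorbs the
         term [a m] at each step. *)
      assert (HQ : forall m, quad_diff (Om i0) (eps * (1 - (/ 100) ^ m))
        (fun w => T m (upd x i0 w) - f (upd x i0 w))%C).
      { induction m as [|m IH].
        - apply quad_diff_ext with (fun _ => RtoC 0); [intros w; simpl; ring|].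
          apply quad_diff_weaken with 0; [simpl; lra|apply quad_diff_const].
        - apply quad_diff_ext with (fun w => (T m (upd x i0 w) - f (upd x i0 w))
            + a m * Hs m (T m) (upd x i0 w (ix m)))%C; [intros w; rewrite TS; ring|].
          apply quad_diff_weaken with (eps * (1 - (/ 100) ^ m) + a m * 1).
          { unfold a. simpl pow. assert (P := pow100_pos m). nra. }
          apply quad_diff_plus; [exact IH|].
          apply (quad_diff_scal _ 1 (a m) (fun w => Hs m (T m) (upd x i0 w (ix m)))); [left; apply Ha|].
          (* The new term depends on [w] only when its variable is [i0]; otherwise it is
             constant. *)
          unfold upd. destruct (ClassicalDescription.excluded_middle_informative (ix m = i0)) as [E|E].
          + rewrite <- E. apply (HHs m (T m) (HT m)).
          + apply quad_diff_weaken with 0; [lra|apply quad_diff_const]. }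
      assert (HR : quad_diff (Om i0) eps (fun w => g (upd x i0 w) - f (upd x i0 w))%C).
      { apply quad_diff_limit with (u := fun m w => (T m (upd x i0 w) - f (upd x i0 w))%C).
        - intros m. apply quad_diff_weaken with (2 := HQ m). assert (P := pow100_pos m). nra.
        - intros w Hw del Hdel. destruct (Hsmall del Hdel) as [N HN]. exists N. intros m Hm.
          replace (T m (upd x i0 w) - f (upd x i0 w) - (g (upd x i0 w) - f (upd x i0 w)))%C
            with (T m (upd x i0 w) - g (upd x i0 w))%C by ring.
          eapply Rle_lt_trans; [|apply (HN m Hm)]. apply Hg.
          apply in_Om_in_clOm, in_Om_upd; assumption. }
      apply (quad_diff_holo_at (Om i0) eps _ (x i0) (Hop i0)) in HR; [|apply Hx].
      assert (Hfx := proj2 HA x Hx i0). unfold holo_at in *.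
      apply ex_derive_ext with (fun w => plus (g (upd x i0 w) - f (upd x i0 w))%C (f (upd x i0 w))).
      + intros w. change ((g (upd x i0 w) - f (upd x i0 w)) + f (upd x i0 w) = g (upd x i0 w))%C. ring.
      + apply (@ex_derive_plus C_AbsRing C_NormedModule
          (fun w => (g (upd x i0 w) - f (upd x i0 w))%C) (fun w => f (upd x i0 w))); assumption. }
  exists g. split.
  - apply (S_I_iff_steep e Om k V phi g He HH). split; [exact HgA|].
    intros q i0 j Hq Hj. destruct (decode_surj e q i0 j He Hq) as [m Em].
    destruct (HHs m (T m) (HT m)) as [_ Hst]. unfold ix in Hst. rewrite Em in Hst.
    cbn [fst snd] in Hst.
    (* The tail after [T (S m)] is at most [4/99 * a m], and twice this is [8/99 * a m], less than
       the margin [a m / 8]. *)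
    apply (steep_perturb Om k V phi q i0 j (a m / 8) 0 (a m * (4 / 99)) (T (S m)) g); auto.
    + intros x Hx. eapply Rle_trans; [apply (Hg x Hx (S m))|]. unfold a. simpl pow.
      right. field.
    + generalize (Ha m). lra.
    + intros r Hr Hrj th v Hv Hv0. destruct (Hst Hj r Hr Hrj th v Hv Hv0) as [t Ht].
      exists t. rewrite !TS. unfold ix. rewrite Em. exact Ht.
  - exists (eps / 2). split; [lra|]. intros x Hx. assert (K := Hg x Hx 0%nat).
    change (T 0%nat x) with (f x) in K. rewrite pow_O in K. lra.
Qed.

Theorem theorem5p6 (I : Type) (e : nat -> I)
  (e_bij : (forall m m', e m = e m' -> m = m') /\ (forall i, exists m, e m = i))
  (Om : I -> C -> Prop) (k : I -> nat) (V : I -> nat -> Chat -> Prop)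
  (phi : I -> nat -> C -> Chat)
  (Hset : setting Om k V phi) :
  GdeltaA Om (S_I Om k phi) /\ denseA Om (S_I Om k phi).
Proof.
  destruct e_bij as [_ He]. assert (HH := setting_holes Om k V phi Hset). split.
  - apply (S_I_Gdelta e Om k V phi He HH).
  - apply (S_I_dense e Om k V phi He HH). intros i. apply (Hset i).
Qed.
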